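(* Let $d_1\ge 3$ be an integer and let $G(x)\in\mathbb{Z}_{\ge 0}[x]$ be a polynomial with nonnegative integer coefficients, of degree $d_2\ge 0$, with $G(0)\neq 0$ and $G(1)\ge 3$. Let $(x_n)_{n\ge 0}$ be the sequence defined by $x_0=x_1=1$ and $$x_{n+2}\,x_n=x_{n+1}^{d_1}\,G(x_{n+1})\qquad(n\ge 0).$$ (Then $(x_n)$ is a sequence of positive integers with $x_n^2\mid x_{n+1}$.) Then the number $$S=\sum_{j=1}^{\infty}\frac{1}{x_j}$$ is transcendental. *)

(* Defs.v *)
From HB Require Export structures.
From mathcomp Require Export all_boot all_order all_algebra.
From mathcomp Require Export all_classical all_reals all_analysis.
Set Implicit Arguments.
Unset Strict Implicit.
Unset Printing Implicit Defensive.
Import Order.TTheory GRing.Theory Num.Theory.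
Import numFieldNormedType.Exports.
Local Open Scope classical_set_scope.
Local Open Scope ring_scope.

Definition transcendental (R : realType) (z : R) : Prop :=
  ~ algebraicOver (ratr : rat -> R) z.

(* The range starts at 1, so the term 1 / x 0 is left out. *)
Definition recip_psum (R : realType) (x : nat -> R) : nat -> R :=
  fun n => \sum_(1 <= j < n.+1) (x j)^-1.

(* Main.v *)
(* Mahler's method takes the place of Roth's theorem.  With p_n = 1/x_{n+1},
   r_n = x_n/x_{n+1} and the tail T_n = S - sum_{j<=n} 1/x_j, the recurrence
   expresses (p_{n+1}, r_{n+1}) through (p_n, r_n) by power series with rational
   coefficients, so T_n has an asymptotic expansion in rational polynomials in
   p_n and r_n.  Linear algebra gives a nonzero rational polynomial P(p, r, y) of
   degree at most N in each variable with P(p_n, r_n, T_n) = O(x_n^-M), where M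
   grows like N^(3/2).  If S were algebraic, x_{n+1}^{2N} x_n^N P(p_n, r_n, T_n)
   would be, up to a fixed factor, an algebraic integer of fixed degree and of
   height x_n^{O(N)}, and Liouville's inequality would make it vanish for all
   large n.

   It does not: log x_{n+1} - lambda log x_n is bounded for the irrational root
   lambda > 1 of t^2 - (d1 + d2) t + 1, hence every nonzero polynomial in p_n, r_n
   is asymptotic to a single monomial.  A relation of minimal degree for T over
   the rational functions of p_n, r_n, compared with its shift, then forces T_n
   to be rational, which contradicts 0 < T_n <= 2/x_n^2. *)

Require Import Defs.
From HB Require Import structures.
From mathcomp Require Import all_boot all_order all_algebra.
From mathcomp Require Import all_classical all_reals all_analysis.
From mathcomp Require Import perm ring lra zify.
Set Implicit Arguments.
Unset Strict Implicit.
Unset Printing Implicit Defensive.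
Import Order.TTheory GRing.Theory Num.Theory.
Import numFieldNormedType.Exports.
Local Open Scope classical_set_scope.
Local Open Scope ring_scope.

(** * Liouville's inequality through integer matrices *)

Section AlgebraicLowerBound.
Variable R : realType.

Definition int_free (D : nat) (w : 'cV[R]_D) :=
  forall v : 'rV[int]_D, map_mx intr v *m w = 0 -> v = 0.

(* [B] is the matrix of multiplication by [y] on the module spanned by [w]. *)
Definition mult_mx (D : nat) (w : 'cV[R]_D) (B : 'M[int]_D) (y : R) :=
  map_mx intr B *m w = y *: w.

Lemma int_poly_of_algebraic (s : R) : algebraicOver (ratr : rat -> R) s ->
  exists2 f : {poly int}, f != 0 & root (map_poly intr f) s.
Proof.
case=> p pn0 ps; have [q [a an0 pE]] := rat_poly_scale p.
exists q.
  by apply: contraNneq pn0 => q0; rewrite pE q0 map_poly0 scaler0.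
move: ps; rewrite pE linearZ /= /root hornerZ mulf_eq0 => /orP[|].
  by rewrite fmorph_eq0 invr_eq0 intr_eq0 (negPf an0).
rewrite -map_poly_comp (@eq_map_poly _ _ _ (intr : int -> R)) // => z /=.
exact: ratr_int.
Qed.

Lemma minimal_int_poly (s : R) (f : {poly int}) : f != 0 ->
  root (map_poly intr f) s ->
  exists g : {poly int}, [/\ g != 0, root (map_poly intr g) s &
    forall h : {poly int}, root (map_poly intr h) s ->
      (size h < size g)%N -> h = 0].
Proof.
have [n] := ubnP (size f); elim: n f => // n IH f szf fn0 fs.
have [[h [hs hf hn0]]|nh] :=
  pselect (exists h : {poly int}, [/\ root (map_poly intr h) s,
    (size h < size f)%N & h != 0]).
  by apply: (IH h) => //; apply: leq_trans hf _.
exists f; split => // h hs hf; apply: contrapT => /eqP hn0.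
by apply: nh; exists h.
Qed.

(** Take [g], an integer polynomial of least degree vanishing at [s]. The vector [w] lists the
    powers 1, s, ..., s^D, which are free over the integers by minimality. With [q] the leading
    coefficient of [g], the number [q s] acts through [q] times the companion matrix, which is
    integral. *)
Lemma algebraic_mult_mx (s : R) : algebraicOver (ratr : rat -> R) s ->
  exists D (w : 'cV[R]_D.+1) (q : nat) (C : 'M[int]_D.+1),
    [/\ w ord0 ord0 = 1, int_free w, (0 < q)%N & mult_mx w C (q%:R * s)].
Proof.
move=> /int_poly_of_algebraic[f fn0 fs].
have [{fn0 fs}g [gn0 gs gmin]] := minimal_int_poly fn0 fs.
wlog lg : g gn0 gs gmin / 0 < lead_coef g.
  move=> W; have [lg|lg|/eqP] := ltgtP 0 (lead_coef g); last first.
  - by rewrite eq_sym lead_coef_eq0 (negPf gn0).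
  - apply: (W (- g)); rewrite ?oppr_eq0 ?lead_coefN ?oppr_gt0 //.
      by rewrite rmorphN /= /root hornerN oppr_eq0.
    by move=> h; rewrite size_polyN; apply: gmin.
  - exact: (W g).
have sz1 : (1 < size g)%N.
  rewrite ltnNge; apply/negP => sz.
  have gC := size1_polyC sz; move: gs gn0; rewrite gC map_polyC /root hornerC /=.
  by rewrite intr_eq0 polyC_eq0 => ->.
have [D szg] : exists D, size g = D.+2 by exists (size g).-2; case: size sz1 => [|[]].
pose q := `|lead_coef g|%N.
have qE : (q%:R : R) = (lead_coef g)%:~R.
  by rewrite /q natr_absz ger0_norm // ltW.
exists D, (\col_i s ^+ i), q,
  (\matrix_(i, j) (if (i < D)%N then (lead_coef g) * ((i.+1 == j)%N)%:R else - g`_j)).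
split.
- by rewrite mxE expr0.
- move=> v /matrixP/(_ ord0 ord0); rewrite !mxE => v0.
  pose h := \poly_(i < D.+1) v ord0 (inord i).
  have h0 : h = 0.
    apply: gmin; last by rewrite szg ltnS size_poly.
    rewrite /root -[X in _ == X]v0; apply/eqP.
    rewrite (@horner_coef_wide _ D.+1); last first.
      by rewrite (leq_trans (size_poly _ _))// size_poly.
    apply: eq_bigr => i _; rewrite coef_map /= coef_poly ltn_ord inord_val.
    by rewrite !mxE.
  apply/rowP => j; rewrite mxE.
  by move/polyP/(_ j): h0; rewrite coef_poly ltn_ord inord_val coef0.
- by rewrite /q absz_gt0 gt_eqF.
- apply/colP => i; rewrite !mxE.
  have [iD|iD] := ltnP i D.
    rewrite (bigD1 (Ordinal (iD : (i.+1 < D.+1)%N))) //= big1 => [|j ji].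
      by rewrite !mxE iD /= eqxx mulr1 addr0 qE exprS mulrA.
    rewrite !mxE iD; case: eqP => [e|]; last by rewrite mulr0 mul0r.
    by move: ji; rewrite -val_eqE /= e eqxx.
  have iE : i = D :> nat by apply/eqP; rewrite eqn_leq iD -ltnS ltn_ord.
  transitivity (- \sum_(j < D.+1) (g`_j)%:~R * s ^+ j).
    rewrite -sumrN; apply: eq_bigr => j _.
    by rewrite !mxE iE ltnn rmorphN mulNr.
  move: gs; rewrite /root (@horner_coef_wide _ D.+2); last first.
    by rewrite -szg size_poly.
  rewrite big_ord_recr /= coef_map /= addr_eq0 => /eqP.
  under eq_bigr do rewrite coef_map /=.
  move=> ->; rewrite opprK iE qE exprS mulrA /lead_coef szg.
  by congr (_ * _ * _).
Qed.

Lemma det_norm_le (D : nat) (A : 'M[int]_D) (h : R) :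
  (forall i j, `|(A i j)%:~R : R| <= h) -> `|(\det A)%:~R : R| <= (D`!)%:R * h ^+ D.
Proof.
move=> Ah; rewrite /determinant rmorph_sum /=.
apply: le_trans (ler_norm_sum _ _ _) _.
rewrite -{1}(card_Sn D) -mulr_natl mulr1 -sum1_card natr_sum mulr_suml.
rewrite (eq_bigl predT) ; last by move=> t; rewrite inE.
apply: ler_sum => t _; rewrite mul1r rmorphM /= normrM rmorphXn /= normrX.
rewrite rmorphN rmorph1 normrN1 expr1n mul1r rmorph_prod normr_prod.
rewrite -[X in h ^+ X]card_ord -prodr_const; apply: ler_prod => i _.
by rewrite normr_ge0 Ah.
Qed.

(** A nonzero integer row [v] with [v B = 0] would give [y (v w) = 0], against freeness, so [det B]
    is a nonzero integer. Row 0 of [adj(B) B w = det(B) w] writes it as [y] times a fixed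
    combination of cofactors, each at most [D! h^D]. *)
Lemma mult_mx_lower_bound (D : nat) (w : 'cV[R]_D.+1) :
  w ord0 ord0 = 1 -> int_free w -> exists K : R,
  forall (B : 'M[int]_D.+1) (y h : R), mult_mx w B y -> y != 0 ->
    (forall i j, `|(B i j)%:~R| <= h) -> 1 <= K * `|y| * h ^+ D.
Proof.
move=> w0 wf; exists (\sum_k (D`!)%:R * `|w k ord0|) => B y h Bw yn0 Bh.
have dn0 : \det B != 0.
  apply/negP => /det0P[v vn0 vB]; case/negP: vn0; apply/eqP/wf.
  have : map_mx intr v *m (map_mx intr B *m w) = 0.
    by rewrite mulmxA -map_mxM vB /= map_mx0 mul0mx.
  rewrite Bw -scalemxAr => /eqP; rewrite scaler_eq0 (negPf yn0) /=.
  by move/eqP.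
have d1 : 1 <= `|(\det B)%:~R : R|.
  rewrite -intr_norm -[1]/(1%:~R) ler_int; have := normr_gt0 (\det B).
  by rewrite dn0; lia.
have E : (\det B)%:~R = y * \sum_k (\adj B ord0 k)%:~R * w k ord0.
  have /matrixP/(_ ord0 ord0) : map_mx intr (\adj B) *m (map_mx intr B *m w) =
      (\det B)%:~R *: w.
    by rewrite mulmxA -map_mxM mul_adj_mx map_scalar_mx mul_scalar_mx.
  rewrite Bw -scalemxAr mxE [RHS]mxE w0 mulr1 => <-.
  by rewrite mxE; congr (_ * _); apply: eq_bigr => k _; rewrite mxE.
apply: le_trans d1 _; rewrite E normrM -mulrA [leRHS]mulrC -mulrA.
apply: ler_wpM2l => //; rewrite mulr_sumr.
apply: le_trans (ler_norm_sum _ _ _) _; apply: ler_sum => k _.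
rewrite normrM mulrA; apply: ler_wpM2r => //.
rewrite mxE /cofactor rmorphM normrM rmorphXn /= rmorphN rmorph1 normrX.
rewrite normrN1 expr1n mul1r mulrC.
by apply: det_norm_le => i j; rewrite !mxE.
Qed.

End AlgebraicLowerBound.

(** * Integral matrices of controlled size along the sequence *)

Section IntegralMatrices.
Variables (R : realType) (x : nat -> R) (D : nat) (w : 'cV[R]_D.+1).
Hypothesis x_ge1 : forall n, 1 <= x n.

(* Up to a fixed positive integer factor, [y n] acts on the module spanned by
   [w] through an integer matrix with entries [O(x n ^+ e)]. *)
Definition mx_height (e : nat) (y : nat -> R) :=
  exists (q : nat) (C : R), (0 < q)%N /\ \forall n \near \oo,
    exists B : 'M[int]_D.+1, mult_mx w B (q%:R * y n) /\
      forall i j, `|(B i j)%:~R| <= C * x n ^+ e.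

Lemma mx_height_int (e : nat) (y : nat -> R) (C : R) :
  (\forall n \near \oo, (exists k : int, y n = k%:~R) /\ `|y n| <= C * x n ^+ e) ->
  mx_height e y.
Proof.
move=> Hy; exists 1%N, C; split=> //; apply: filterS Hy => n [[k kE] yC].
exists (k%:M); split.
  by rewrite /mult_mx map_scalar_mx mul_scalar_mx mul1r kE.
move=> i j; rewrite mxE; case: (i == j); first by rewrite mulr1n -kE.
by rewrite mulr0n normr0; apply: le_trans yC.
Qed.

Lemma mx_height_rat (c : rat) : mx_height 0 (fun=> ratr c).
Proof.
exists `|denq c|%N, `|(numq c)%:~R|; split; first by rewrite absz_gt0 denq_eq0.
apply: nearW => n; exists ((numq c)%:M); split.
  rewrite /mult_mx map_scalar_mx mul_scalar_mx; congr (_ *: _).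
  rewrite natr_absz ger0_norm ?denq_ge0 // /ratr mulrCA divff ?mulr1 //.
  by rewrite intr_eq0 denq_eq0.
by move=> i j; rewrite mxE expr0 mulr1; case: (i == j); rewrite ?mulr1n // mulr0n normr0.
Qed.

Lemma mx_heightD (e : nat) (y z : nat -> R) :
  mx_height e y -> mx_height e z -> mx_height e (fun n => y n + z n).
Proof.
move=> [q [C [q0 Hy]]] [q' [C' [q0' Hz]]].
exists (q * q')%N, (q'%:R * C + q%:R * C'); split; first by rewrite muln_gt0 q0.
apply: filterS2 Hy Hz => n [B [Bw Bh]] [B' [Bw' Bh']].
exists (q'%:Z *: B + q%:Z *: B'); split.
  rewrite /mult_mx map_mxD !map_mxZ mulmxDl -!scalemxAl Bw Bw' !scalerA.
  by rewrite -scalerDl natrM /=; congr (_ *: _); ring.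
move=> i j; rewrite !mxE rmorphD !rmorphM /=.
apply: le_trans (ler_normD _ _) _; rewrite !normrM !normr_nat mulrDl -!mulrA.
by apply: lerD; apply: ler_wpM2l; rewrite ?ler0n ?Bh ?Bh'.
Qed.

Lemma mx_heightM (e f : nat) (y z : nat -> R) :
  mx_height e y -> mx_height f z -> mx_height (e + f) (fun n => y n * z n).
Proof.
move=> [q [C [q0 Hy]]] [q' [C' [q0' Hz]]].
exists (q * q')%N, (D.+1%:R * C * C'); split; first by rewrite muln_gt0 q0.
apply: filterS2 Hy Hz => n [B [Bw Bh]] [B' [Bw' Bh']].
exists (B *m B'); split.
  rewrite /mult_mx map_mxM -mulmxA Bw' -scalemxAr Bw scalerA natrM.
  by congr (_ *: _); ring.
move=> i j; rewrite mxE rmorph_sum /=; apply: le_trans (ler_norm_sum _ _ _) _.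
have -> : D.+1%:R * C * C' * x n ^+ (e + f) =
    \sum_(k < D.+1) (C * x n ^+ e) * (C' * x n ^+ f).
  by rewrite sumr_const card_ord -mulr_natl exprD; ring.
by apply: ler_sum => k _; rewrite rmorphM normrM; apply: ler_pM => //; [apply: Bh|apply: Bh'].
Qed.

Lemma mx_height_le (e f : nat) (y : nat -> R) : (e <= f)%N ->
  mx_height e y -> mx_height f y.
Proof.
move=> ef [q [C [q0 Hy]]]; exists q, `|C|; split => //.
apply: filterS Hy => n [B [Bw Bh]]; exists B; split => // i j.
apply: le_trans (Bh i j) _; apply: le_trans (ler_wpM2r _ (ler_norm C)) _.
  by rewrite exprn_ge0 // (le_trans _ (x_ge1 n)).
by apply: ler_wpM2l => //; rewrite ler_weXn2l.
Qed.

Lemma mx_heightX (e k : nat) (y : nat -> R) :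
  mx_height e y -> mx_height (k * e) (fun n => y n ^+ k).
Proof.
move=> ye; elim: k => [|k IH].
  rewrite mul0n; apply: (@mx_height_int _ _ 1); apply: nearW => n.
  by split; [exists 1; rewrite expr0|rewrite !expr0 normr1 mulr1].
rewrite mulSn; under eq_fun do rewrite exprS.
exact: mx_heightM.
Qed.

Lemma mx_height_sum (I : Type) (s : seq I) (e : nat) (y : I -> nat -> R) :
  (forall i, mx_height e (y i)) -> mx_height e (fun n => \sum_(i <- s) y i n).
Proof.
move=> ye; elim: s => [|i s IH].
  apply: (@mx_height_int _ _ 0); apply: nearW => n.
  by rewrite big_nil mul0r normr0; split=> //; exists 0.
under eq_fun do rewrite big_cons.
exact: mx_heightD.
Qed.

(** The cofactors in Liouville's inequality are minors of order [D], so entries of size x_n^e cost a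
    factor x_n^(e D). *)
Lemma mx_height_lower_bound (e : nat) (y : nat -> R) :
  w ord0 ord0 = 1 -> int_free w -> mx_height e y ->
  exists C : R, \forall n \near \oo,
    y n != 0 -> 1 <= C * `|y n| * x n ^+ (e * D).
Proof.
move=> w0 /(mult_mx_lower_bound w0)[K HK] [q [C [q0 Hy]]].
exists (K * q%:R * C ^+ D); apply: filterS Hy => n [B [Bw Bh]] yn0.
have /(_ _ Bh) := HK B (q%:R * y n) (C * x n ^+ e) Bw.
rewrite mulf_neq0 ?pnatr_eq0 -?lt0n // => /(_ isT) H.
apply: le_trans H _; rewrite normrM exprMn exprM normr_nat le_eqVlt.
by apply/orP; left; apply/eqP; ring.
Qed.

End IntegralMatrices.

(** * Evaluation of bivariate polynomials, and a homogeneous linear system *)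

Section BivariateEvaluation.
Variable R : realType.

(** The inner variable is sent to [a] and the outer one to [b]. Written as a composition of ring
    morphisms, the evaluation inherits that structure. *)
Definition ev2 (a b : R) : {poly {poly rat}} -> R :=
  horner_eval b \o map_poly (horner_eval a \o map_poly ratr).

HB.instance Definition _ (a b : R) := GRing.RMorphism.on (ev2 a b).

Lemma ev2C (a b : R) (c : rat) : ev2 a b c%:P%:P = ratr c.
Proof. by rewrite /ev2 /= map_polyC /= /horner_eval hornerC map_polyC hornerC. Qed.

Lemma ev2X1 (a b : R) : ev2 a b 'X%:P = a.
Proof. by rewrite /ev2 /= map_polyC /= /horner_eval hornerC map_polyX hornerX. Qed.

Lemma ev2X2 (a b : R) : ev2 a b 'X = b.
Proof. by rewrite /ev2 /= map_polyX /= /horner_eval hornerX. Qed.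

Lemma ev2_coef (a b : R) (Q : {poly {poly rat}}) :
  ev2 a b Q = \sum_(k < size Q) \sum_(i < size Q`_k) ratr Q`_k`_i * a ^+ i * b ^+ k.
Proof.
rewrite /ev2 /= {1}/horner_eval (@horner_coef_wide _ (size Q)) ?size_poly //.
apply: eq_bigr => k _; rewrite coef_map /= /horner_eval (@horner_coef_wide _ (size Q`_k)) ?size_poly //.
by rewrite mulr_suml; apply: eq_bigr => i _; rewrite coef_map.
Qed.

End BivariateEvaluation.

(** More unknowns than equations leave a nonzero row kernel. Arbitrary finite index types let
    triples of exponents index the unknowns directly. *)
Lemma nontrivial_kernel (F : fieldType) (I J : finType) (A : I -> J -> F) :
  (#|J| < #|I|)%N ->
  exists2 v : I -> F, (exists i, v i != 0) & forall j, \sum_i v i * A i j = 0.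
Proof.
move=> JI; pose M := \matrix_(i < #|I|, j < #|J|) A (enum_val i) (enum_val j).
have : kermx M != 0.
  by rewrite -mxrank_eq0 mxrank_ker -lt0n subn_gt0 (leq_ltn_trans (rank_leq_col M)).
case/rowV0Pn => u /sub_kermxP uM /rV0Pn[i ui].
exists (fun i => u ord0 (enum_rank i)).
  by exists (enum_val i); rewrite enum_valK.
move=> j; move/rowP/(_ (enum_rank j)): uM; rewrite !mxE => uMj; rewrite -[RHS]uMj.
rewrite [RHS](reindex (@enum_rank I)); last by apply: onW_bij; apply: enum_rank_bij.
by apply: eq_bigr => k _; rewrite mxE !enum_rankK.
Qed.

(** * Asymptotic expansions in p_n and r_n *)

Section Expansions.
Variables (R : realType) (x p r : nat -> R).
Hypothesis x_ge1 : forall n, 1 <= x n.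
Hypothesis p_bound : forall n, 0 <= p n <= (x n)^-1.
Hypothesis r_bound : forall n, 0 <= r n <= (x n)^-1.

Definition bigOx (M : nat) (f : nat -> R) :=
  exists C : R, \forall n \near \oo, `|f n| <= C * (x n)^-1 ^+ M.

Lemma x_gt0 n : 0 < x n. Proof. exact: lt_le_trans (x_ge1 n). Qed.

Lemma xV_bound n : 0 <= (x n)^-1 <= 1.
Proof. by rewrite invr_ge0 ltW ?x_gt0 //= invf_le1 ?x_gt0. Qed.

Lemma bigOx_le (M M' : nat) f : (M' <= M)%N -> bigOx M f -> bigOx M' f.
Proof.
move=> MM [C HC]; exists `|C|; apply: filterS HC => n fC.
have /andP[z0 z1] := xV_bound n.
apply: le_trans fC (le_trans (ler_wpM2r _ (ler_norm C)) _); first exact: exprn_ge0.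
by apply: ler_wpM2l => //; rewrite ler_wiXn2l.
Qed.

Lemma bigOxD (M : nat) f g :
  bigOx M f -> bigOx M g -> bigOx M (fun n => f n + g n).
Proof.
move=> [C HC] [C' HC']; exists (C + C'); apply: filterS2 HC HC' => n fC gC.
by rewrite mulrDl; apply: le_trans (ler_normD _ _) (lerD fC gC).
Qed.

Lemma bigOxM (M M' : nat) f g :
  bigOx M f -> bigOx M' g -> bigOx (M + M') (fun n => f n * g n).
Proof.
move=> [C HC] [C' HC']; exists (C * C'); apply: filterS2 HC HC' => n fC gC.
by rewrite normrM exprD mulrACA ler_pM.
Qed.

Lemma bigOx_cst (c : R) : bigOx 0 (fun=> c).
Proof. by exists `|c|; apply: nearW => n; rewrite expr0 mulr1. Qed.

Lemma bigOx_p : bigOx 1 p.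
Proof.
exists 1; apply: nearW => n; have /andP[p0 pz] := p_bound n.
by rewrite ger0_norm // mul1r expr1.
Qed.

Lemma bigOx_r : bigOx 1 r.
Proof.
exists 1; apply: nearW => n; have /andP[p0 pz] := r_bound n.
by rewrite ger0_norm // mul1r expr1.
Qed.

Lemma bigOxX (M k : nat) f : bigOx M f -> bigOx (k * M) (fun n => f n ^+ k).
Proof.
move=> fM; elim: k => [|k IH]; first exact: (bigOx_cst 1).
rewrite mulSn; under eq_fun do rewrite exprS.
exact: bigOxM.
Qed.

Lemma bigOx_sum (I : Type) (s : seq I) (M : nat) (f : I -> nat -> R) :
  (forall i, bigOx M (f i)) -> bigOx M (fun n => \sum_(i <- s) f i n).
Proof.
move=> fM; elim: s => [|i s IH].
  by exists 0; apply: nearW => n; rewrite big_nil normr0 mul0r.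
under eq_fun do rewrite big_cons.
exact: bigOxD.
Qed.

(** A monomial outside the square [i, k < M] has an exponent at least [M], and both [p n] and [r n]
    are at most 1/x_n. *)
Lemma bigOx_ev2 (M : nat) (Q : {poly {poly rat}}) :
  (forall i k, (i < M)%N -> (k < M)%N -> Q`_k`_i = 0) ->
  bigOx M (fun n => ev2 (p n) (r n) Q).
Proof.
move=> Q0; under eq_fun do rewrite ev2_coef.
apply: bigOx_sum => k; apply: bigOx_sum => i.
have [/andP[iM kM]|ik] := boolP ((i < M) && (k < M))%N; last first.
  apply: (@bigOx_le (0 + i * 1 + k * 1)); first by lia.
  by apply: bigOxM (bigOxX _ bigOx_r); apply: bigOxM (bigOxX _ bigOx_p); apply: bigOx_cst.
exists 0; apply: nearW => n.
by rewrite Q0 // rmorph0 !mul0r normr0.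
Qed.

(** Each order [M] has its own polynomial, in place of one formal power series. Rational
    coefficients let the later linear algebra take place over the rationals. *)
Definition has_expansion (f : nat -> R) := forall M, exists Q : {poly {poly rat}},
  bigOx M (fun n => f n - ev2 (p n) (r n) Q).

Lemma has_expansion_bigOx f : has_expansion f -> bigOx 0 f.
Proof.
move=> /(_ 0%N)[Q fQ].
have := bigOxD fQ (@bigOx_ev2 0 Q (fun _ _ => ltac:(by []))).
by under eq_fun do rewrite subrK.
Qed.

Lemma has_expansion_ev2 Q : has_expansion (fun n => ev2 (p n) (r n) Q).
Proof.
by move=> M; exists Q; exists 0; apply: nearW => n; rewrite subrr normr0 mul0r.
Qed.

Lemma has_expansion_rat (c : rat) : has_expansion (fun=> ratr c).
Proof. by have := has_expansion_ev2 c%:P%:P; under eq_fun do rewrite ev2C. Qed.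

Lemma has_expansion_p : has_expansion p.
Proof. by have := has_expansion_ev2 'X%:P; under eq_fun do rewrite ev2X1. Qed.

Lemma has_expansion_r : has_expansion r.
Proof. by have := has_expansion_ev2 'X; under eq_fun do rewrite ev2X2. Qed.

Lemma has_expansionD f g : has_expansion f -> has_expansion g ->
  has_expansion (fun n => f n + g n).
Proof.
move=> hf hg M; have [Q fQ] := hf M; have [Q' gQ] := hg M.
exists (Q + Q'); have := bigOxD fQ gQ; congr bigOx; apply/funext => n.
by rewrite rmorphD /=; ring.
Qed.

Lemma has_expansionM f g : has_expansion f -> has_expansion g ->
  has_expansion (fun n => f n * g n).
Proof.
move=> hf hg M; have [Q fQ] := hf M; have [Q' gQ] := hg M.
exists (Q * Q').
have Q_O : bigOx 0 (fun n => ev2 (p n) (r n) Q) by apply: bigOx_ev2.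
have := bigOxD (bigOxM (has_expansion_bigOx hg) fQ) (bigOxM Q_O gQ).
by congr bigOx; apply/funext => n; rewrite rmorphM /=; ring.
Qed.

Lemma has_expansion_sum (I : Type) (s : seq I) (f : I -> nat -> R) :
  (forall i, has_expansion (f i)) -> has_expansion (fun n => \sum_(i <- s) f i n).
Proof.
move=> hf; elim: s => [|i s IH].
  under eq_fun do rewrite big_nil.
  by have := has_expansion_rat 0; rewrite rmorph0.
under eq_fun do rewrite big_cons.
exact: has_expansionD.
Qed.

Lemma has_expansionX k f : has_expansion f -> has_expansion (fun n => f n ^+ k).
Proof.
move=> hf; elim: k => [|k IH].
  under eq_fun do rewrite expr0.
  by have := has_expansion_rat 1; rewrite rmorph1.
under eq_fun do rewrite exprS.
exact: has_expansionM.
Qed.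

Lemma has_expansion_horner (q : {poly rat}) f : has_expansion f ->
  has_expansion (fun n => (map_poly ratr q).[f n]).
Proof.
move=> hf; under eq_fun do rewrite horner_coef size_map_poly.
apply: has_expansion_sum => i; apply: has_expansionM (has_expansionX _ hf).
by rewrite coef_map; apply: has_expansion_rat.
Qed.

Lemma has_expansion_ev2_comp Q f g : has_expansion f -> has_expansion g ->
  has_expansion (fun n => ev2 (f n) (g n) Q).
Proof.
move=> hf hg; under eq_fun do rewrite ev2_coef.
apply: has_expansion_sum => k; apply: has_expansion_sum => i.
apply: has_expansionM (has_expansionX _ hg).
exact: has_expansionM (has_expansion_rat _) (has_expansionX _ hf).
Qed.

Lemma has_expansion_approx f :
  (forall M, exists2 g, has_expansion g & bigOx M (fun n => f n - g n)) ->
  has_expansion f.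
Proof.
move=> hf M; have [g hg fg] := hf M; have [Q gQ] := hg M; exists Q.
have := bigOxD fg gQ; congr bigOx; apply/funext => n; ring.
Qed.

(* The [N.+1 ^ 3] coefficients outnumber the [M * M] vanishing conditions, so an
   order of vanishing far larger than the degree is reached. *)
Lemma auxiliary_polynomial (T : nat -> R) (N M : nat) :
  has_expansion T -> (M * M < N.+1 ^ 3)%N ->
  exists2 c : 'I_N.+1 * 'I_N.+1 * 'I_N.+1 -> rat, exists t, c t != 0 &
    bigOx M (fun n => \sum_t ratr (c t) * p n ^+ t.1.1 * r n ^+ t.1.2 * T n ^+ t.2).
Proof.
(* Replacing [T] by its approximation [Q] turns vanishing to order [M] into linear conditions on the
   unknown coefficients. *)
move=> hT MN; have [Q TQ] := hT M.
pose m (t : 'I_N.+1 * 'I_N.+1 * 'I_N.+1) : {poly {poly rat}} :=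
  'X%:P ^+ t.1.1 * 'X ^+ t.1.2 * Q ^+ t.2.
have [|c cn0 c0] := @nontrivial_kernel rat ('I_N.+1 * 'I_N.+1 * 'I_N.+1)%type
  ('I_M * 'I_M)%type (fun t j => (m t)`_(j.1)`_(j.2)).
  by rewrite !card_prod !card_ord; move: MN; rewrite !expnS expn0 muln1 mulnA.
exists c => //; pose E := \sum_t (c t)%:P%:P * m t.
have EO : bigOx M (fun n => ev2 (p n) (r n) E).
  apply: bigOx_ev2 => i k iM kM.
  rewrite /E coef_sum coef_sum -[RHS](c0 (Ordinal kM, Ordinal iM)).
  by apply: eq_bigr => t _; rewrite !coefCM.
have TO := has_expansion_bigOx hT.
have QO : bigOx 0 (fun n => ev2 (p n) (r n) Q) by apply: bigOx_ev2.
have pO : bigOx 0 p by apply: bigOx_le bigOx_p.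
have rO : bigOx 0 r by apply: bigOx_le bigOx_r.
have X0 k f : bigOx 0 f -> bigOx 0 (fun n => f n ^+ k).
  by move=> /(@bigOxX 0 k); rewrite muln0.
(* The difference T^k - Q^k is a bounded multiple of T - Q. *)
have pw k : bigOx M (fun n => T n ^+ k - ev2 (p n) (r n) Q ^+ k).
  under eq_fun do rewrite subrXX mulrC.
  apply: (@bigOxM 0); last exact: TQ.
  apply: bigOx_sum => i; apply: (@bigOxM 0 0); exact: X0.
have := bigOxD EO (bigOx_sum (index_enum _) (fun t =>
  (bigOxM (bigOxM (bigOxM (bigOx_cst (ratr (c t))) (X0 t.1.1 _ pO))
    (X0 t.1.2 _ rO)) (pw t.2)))).
congr bigOx; apply/funext => n.
rewrite /E rmorph_sum /= -big_split /=; apply: eq_bigr => t _.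
rewrite /m !rmorphM !rmorphXn /= ev2C ev2X1 ev2X2; ring.
Qed.

End Expansions.

(** * Dominant monomials and rational functions of p_n and r_n *)

Section MonomialAsymptotics.
Variables (R : realType) (p r l : nat -> R) (lam W : R).
Hypothesis p_exp : forall n, p n = expR (- l n.+1).
Hypothesis r_exp : forall n, r n = expR (l n - l n.+1).
Hypothesis l_cvg : l n @[n --> \oo] --> +oo.
Hypothesis l_ratio : forall n, `|l n.+1 - lam * l n| <= W.

(** Since [l n.+1] is [lam * l n] up to a bounded error, p_n^i r_n^k is exp(- weight * l n) up to a
    factor bounded above and below: the weight is its rate of decay. Injectivity of the weight means
    that distinct monomials decay at distinct rates. *)
Definition weight (i k : nat) : R := i%:R * lam + k%:R * (lam - 1).

Hypothesis weight_inj : forall i k i' k', weight i k = weight i' k' ->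
  i = i' /\ k = k'.

Definition mono (i k n : nat) : R := p n ^+ i * r n ^+ k.

Lemma mono_gt0 i k n : 0 < mono i k n.
Proof. by rewrite /mono p_exp r_exp mulr_gt0 // exprn_gt0 // expR_gt0. Qed.

(** The logarithm of the ratio is a bounded multiple of [l n.+1 - lam * l n] minus [dl * l n] with
    [dl > 0], hence tends to minus infinity. *)
Lemma mono_ratio_cvg0 i k i' k' : weight i' k' < weight i k ->
  mono i k n / mono i' k' n @[n --> \oo] --> (0 : R).
Proof.
move=> ww; pose dl := weight i k - weight i' k'.
have dl0 : 0 < dl by rewrite subr_gt0.
pose e : R := (i' + k')%:R - (i + k)%:R.
apply: (@squeeze_cvgr _ _ _ _ (fun=> 0) (fun n => expR (`|e| * W) * expR (- (dl * l n)))).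
- apply: nearW => n; apply/andP; split.
    by rewrite divr_ge0 // ltW // mono_gt0.
  rewrite /mono p_exp r_exp -!expRM_natl -!expRD -expRN -expRD ler_expR.
  have -> : i%:R * - l n.+1 + k%:R * (l n - l n.+1) -
      (i'%:R * - l n.+1 + k'%:R * (l n - l n.+1)) =
      e * (l n.+1 - lam * l n) - dl * l n.
    by rewrite /e /dl /weight !natrD; ring.
  rewrite lerD2r; apply: le_trans (ler_norm _) _.
  by rewrite normrM ler_wpM2l.
- exact: cvg_cst.
- rewrite -(mulr0 (expR (`|e| * W))); apply: cvgM; first exact: cvg_cst.
  have dlc : dl * l n @[n --> \oo] --> +oo.
    apply/cvgryPge => A; move/cvgryPge: l_cvg => /(_ (A / dl)).
    by apply: filterS => n; rewrite ler_pdivrMr // mulrC.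
  exact: (cvg_comp _ _ dlc (@cvgr_expR R)).
Qed.

Lemma cvg_bigsum (I : Type) (s : seq I) (f : I -> nat -> R) (a : I -> R) :
  (forall i, f i n @[n --> \oo] --> a i) ->
  \sum_(i <- s) f i n @[n --> \oo] --> \sum_(i <- s) a i.
Proof.
move=> fa; elim: s => [|i s IH].
  by under eq_fun do rewrite big_nil; rewrite big_nil; apply: cvg_cst.
under eq_fun do rewrite big_cons; rewrite big_cons; exact: cvgD.
Qed.

(** Among the monomials with nonzero coefficient, one of least weight decays slowest. It is unique
    because [weight] is injective, so every other term is negligible against it. *)
Lemma ev2_asymptotic (Q : {poly {poly rat}}) : Q != 0 ->
  exists (c : rat) i k, c != 0 /\
    ev2 (p n) (r n) Q / mono i k n @[n --> \oo] --> (ratr c : R).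
Proof.
(* All inner degrees lie below [m], so the monomials of [Q] fit in one finite box of exponents. *)
move=> Qn0; pose m := (\max_(k < size Q) size (Q`_k)%R)%N.
pose P (t : 'I_(size Q) * 'I_m) := Q`_t.1`_t.2 != 0.
have szk (k : 'I_(size Q)) : (size (Q`_k)%R <= m)%N.
  exact: (@leq_bigmax _ (fun k : 'I_(size Q) => size (Q`_k)%R)).
have [t0 Pt0] : exists t0, P t0.
  have k0 : ((size Q).-1 < size Q)%N by rewrite prednK // lt0n size_poly_eq0.
  have qn0 : Q`_(size Q).-1 != 0 by rewrite -/(lead_coef Q) lead_coef_eq0.
  have i0 : ((size (Q`_(size Q).-1)%R).-1 < m)%N.
    apply: leq_trans (szk (Ordinal k0)); rewrite prednK // lt0n size_poly_eq0.
    exact: qn0.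
  exists (Ordinal k0, Ordinal i0); rewrite /P /=.
  by rewrite -/(lead_coef Q`_(size Q).-1) lead_coef_eq0.
pose wt (t : 'I_(size Q) * 'I_m) := weight t.2 t.1.
case: (@Order.TotalTheory.arg_minP _ _ _ t0 P wt Pt0) => t Pt tmin.
exists Q`_t.1`_t.2, t.2, t.1; split=> //.
have -> : (fun n => ev2 (p n) (r n) Q / mono t.2 t.1 n) = (fun n =>
    \sum_(u : 'I_(size Q) * 'I_m)
      ratr Q`_u.1`_u.2 * (mono u.2 u.1 n / mono t.2 t.1 n)).
  apply/funext => n; rewrite ev2_coef.
  rewrite -(pair_bigA _ (fun (u1 : 'I_(size Q)) (u2 : 'I_m) =>
    ratr Q`_u1`_u2 * (mono u2 u1 n / mono t.2 t.1 n))) /=.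
  rewrite mulr_suml; apply: eq_bigr => k _.
  rewrite (big_ord_widen m (fun i => ratr Q`_k`_i * p n ^+ i * r n ^+ k)) //.
  rewrite big_mkcond /= mulr_suml; apply: eq_bigr => i _.
  case: ltnP => [_|ik]; first by rewrite /mono !mulrA.
  by rewrite nth_default // rmorph0 !mul0r.
rewrite (_ : ratr _ = \sum_(u : 'I_(size Q) * 'I_m)
    (if u == t then ratr Q`_t.1`_t.2 else 0)); last first.
  by rewrite -big_mkcond /= big_pred1_eq.
apply: cvg_bigsum => u; have [->|ut] := eqVneq u t.
  under eq_fun do rewrite divff ?gt_eqF ?mono_gt0 // mulr1.
  exact: cvg_cst.
have [Pu|] := boolP (P u); last first.
  rewrite negbK => /eqP u0; rewrite u0 rmorph0.
  under eq_fun do rewrite mul0r.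
  exact: cvg_cst.
rewrite -[X in _ --> X](mulr0 (ratr Q`_u.1`_u.2)).
apply: cvgM; first exact: cvg_cst.
apply: mono_ratio_cvg0; rewrite lt_neqAle [X in _ && X]tmin // andbT.
apply: contra_neq ut => /weight_inj[e2 e1].
by case: u t e1 e2 {Pu Pt tmin} => [u1 u2] [t1 t2] /= e1 e2;
  congr pair; apply: val_inj.
Qed.

Lemma ev2_neq0 (Q : {poly {poly rat}}) : Q != 0 ->
  \forall n \near \oo, ev2 (p n) (r n) Q != 0.
Proof.
move=> /ev2_asymptotic[c [i [k [cn0 cv]]]].
have rc0 : 0 < `|ratr c : R| by rewrite normr_gt0 fmorph_eq0.
move/cvgrPdist_lt: cv => /(_ _ rc0); apply: filterS => n.
by apply: contraTneq => ->; rewrite mul0r subr0 ltxx.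
Qed.

(** These are the germs at infinity of rational functions over the rationals. Asking [B != 0] as a
    polynomial is enough, since by [ev2_neq0] its values are then eventually nonzero. *)
Definition rational_fun (f : nat -> R) := exists A B : {poly {poly rat}},
  B != 0 /\ \forall n \near \oo, f n = ev2 (p n) (r n) A / ev2 (p n) (r n) B.

Lemma rational_fun_ev2 Q : rational_fun (fun n => ev2 (p n) (r n) Q).
Proof.
exists Q, 1; rewrite oner_neq0; split=> //; apply: nearW => n.
by rewrite rmorph1 divr1.
Qed.

Lemma rational_fun_rat c : rational_fun (fun=> ratr c).
Proof. by have := rational_fun_ev2 c%:P%:P; under eq_fun do rewrite ev2C. Qed.

Lemma rational_fun_p : rational_fun p.
Proof. by have := rational_fun_ev2 'X%:P; under eq_fun do rewrite ev2X1. Qed.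

Lemma rational_fun_r : rational_fun r.
Proof. by have := rational_fun_ev2 'X; under eq_fun do rewrite ev2X2. Qed.

Lemma rational_funD f g : rational_fun f -> rational_fun g ->
  rational_fun (fun n => f n + g n).
Proof.
move=> [A [B [Bn0 fE]]] [A' [B' [Bn0' gE]]].
exists (A * B' + A' * B), (B * B'); split; first by rewrite mulf_neq0.
move/ev2_neq0: Bn0' => Bn0'; move/ev2_neq0: Bn0 => Bn0.
near=> n.
have -> : f n = ev2 (p n) (r n) A / ev2 (p n) (r n) B by near: n.
have -> : g n = ev2 (p n) (r n) A' / ev2 (p n) (r n) B' by near: n.
rewrite rmorphD !rmorphM /= addf_div //; first by near: n.
by near: n.
Unshelve. all: by end_near. Qed.

Lemma rational_funM f g : rational_fun f -> rational_fun g ->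
  rational_fun (fun n => f n * g n).
Proof.
move=> [A [B [Bn0 fE]]] [A' [B' [Bn0' gE]]].
exists (A * A'), (B * B'); split; first by rewrite mulf_neq0.
by apply: filterS2 fE gE => n -> ->; rewrite !rmorphM /= mulf_div.
Qed.

Lemma rational_funV f : rational_fun f -> rational_fun (fun n => (f n)^-1).
Proof.
move=> [A [B [Bn0 fE]]]; have [A0|An0] := eqVneq A 0.
  (* The convention [0^-1 = 0] makes the inverse of the zero germ zero again. *)
  exists 0, B; split=> //; apply: filterS fE => n ->.
  by rewrite A0 !rmorph0 !mul0r invr0.
by exists B, A; split=> //; apply: filterS fE => n ->; rewrite invf_div.
Qed.

Lemma rational_fun_sum (I : Type) (s : seq I) (f : I -> nat -> R) :
  (forall i, rational_fun (f i)) -> rational_fun (fun n => \sum_(i <- s) f i n).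
Proof.
move=> hf; elim: s => [|i s IH].
  under eq_fun do rewrite big_nil.
  by have := rational_fun_rat 0; rewrite rmorph0.
under eq_fun do rewrite big_cons.
exact: rational_funD.
Qed.

Lemma rational_funX f k : rational_fun f -> rational_fun (fun n => f n ^+ k).
Proof.
move=> hf; elim: k => [|k IH].
  under eq_fun do rewrite expr0.
  by have := rational_fun_rat 1; rewrite rmorph1.
under eq_fun do rewrite exprS.
exact: rational_funM.
Qed.

Lemma rational_fun_dichotomy f : rational_fun f ->
  (\forall n \near \oo, f n = 0) \/ (\forall n \near \oo, f n != 0).
Proof.
move=> [A [B [Bn0 fE]]]; have [A0|An0] := eqVneq A 0.
  by left; apply: filterS fE => n ->; rewrite A0 rmorph0 mul0r.
right; move/ev2_neq0: Bn0 => Bn0; move/ev2_neq0: An0 => An0.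
near=> n.
have -> : f n = ev2 (p n) (r n) A / ev2 (p n) (r n) B by near: n.
by rewrite mulf_neq0 ?invr_eq0 //; near: n.
Unshelve. all: by end_near. Qed.

(** The function is asymptotic to [a / b] times a quotient of two monomials. Comparing weights, it
    is unbounded, or tends to 0, or the monomials coincide and the limit is the rational number
    [a / b]. *)
Lemma rational_fun_lim f (kappa : R) : rational_fun f ->
  f n @[n --> \oo] --> kappa -> exists c : rat, kappa = ratr c.
Proof.
move=> [A [B [Bn0 fE]]] fk.
have H := @norm_hausdorff _ R^o.
have [A0|An0] := eqVneq A 0.
  exists 0; rewrite rmorph0; apply: (cvg_unique H fk).
  apply: cvg_near_cst; apply: filterS fE => n ->.
  by rewrite A0 rmorph0 mul0r.
have [a [i [k [an0 Aa]]]] := ev2_asymptotic An0.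
have [b [i' [k' [bn0 Bb]]]] := ev2_asymptotic Bn0.
have ab : f n * (mono i' k' n / mono i k n) @[n --> \oo] --> (ratr (a / b) : R).
  rewrite fmorph_div.
  have : (ev2 (p n) (r n) A / mono i k n) *
      (ev2 (p n) (r n) B / mono i' k' n)^-1 @[n --> \oo] --> (ratr a / ratr b : R).
    by apply: cvgM => //; apply: cvgV => //; rewrite fmorph_eq0.
  apply: cvg_trans; apply: near_eq_cvg; apply: filterS fE => n ->.
  rewrite invf_div !mulf_div; congr (_ / _); exact: mulrC.
have [ww|ww|ww] := ltgtP (weight i k) (weight i' k').
- have ab0 : f n * (mono i' k' n / mono i k n) @[n --> \oo] --> kappa * 0.
    by apply: cvgM => //; apply: mono_ratio_cvg0.
  have /eqP : (ratr (a / b) : R) = kappa * 0 by exact: (cvg_unique H ab ab0).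
  rewrite mulr0.
  by rewrite fmorph_eq0 mulf_eq0 invr_eq0 (negPf an0) (negPf bn0).
- have : f n * (mono i' k' n / mono i k n) * (mono i k n / mono i' k' n)
      @[n --> \oo] --> (ratr (a / b) * 0 : R).
    by apply: cvgM => //; apply: mono_ratio_cvg0.
  rewrite mulr0 => f0.
  exists 0; rewrite rmorph0; apply: (cvg_unique H fk).
  apply: cvg_trans f0; apply: near_eq_cvg; apply: nearW => n /=.
  rewrite -mulrA mulf_div [mono i k n * _]mulrC divff ?mulr1 //.
  by rewrite mulf_neq0 // gt_eqF // mono_gt0.
- have [ei ek] := weight_inj ww; exists (a / b); apply: (cvg_unique H fk).
  apply: cvg_trans ab; apply: near_eq_cvg; apply: nearW => n /=.
  by rewrite ei ek divff ?mulr1 // gt_eqF ?mono_gt0.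
Qed.

(** * Transcendence of the tail over the rational functions of p_n and r_n *)

Section AlgebraicIndependence.
Variable T : nat -> R.
Hypothesis T_shift : forall n, T n.+1 = T n - p n.
Hypothesis T_cvg0 : T n @[n --> \oo] --> (0 : R).
Hypothesis T_irrational : forall n c, T n <> ratr c.
Hypothesis p_rat : forall n, exists c, p n = ratr c.
Hypothesis r_rat : forall n, exists c, r n = ratr c.
Hypothesis p_shift : rational_fun (fun n => p n.+1).
Hypothesis r_shift : rational_fun (fun n => r n.+1).

Lemma ev2_rat n Q : exists c, ev2 (p n) (r n) Q = ratr c.
Proof.
have [c pc] := p_rat n; have [c' rc] := r_rat n.
exists (\sum_(k < size Q) \sum_(i < size Q`_k) Q`_k`_i * c ^+ i * c' ^+ k).
rewrite ev2_coef rmorph_sum; apply: eq_bigr => k _.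
rewrite rmorph_sum; apply: eq_bigr => i _.
by rewrite !rmorphM !rmorphXn /= pc rc.
Qed.

Lemma rational_fun_shift f : rational_fun f -> rational_fun (fun n => f n.+1).
Proof.
move=> [A [B [_ fE]]].
have ev_shift Q : rational_fun (fun n => ev2 (p n.+1) (r n.+1) Q).
  under eq_fun do rewrite ev2_coef.
  apply: rational_fun_sum => k; apply: rational_fun_sum => i.
  apply: rational_funM (rational_funX _ r_shift).
  exact: rational_funM (rational_fun_rat _) (rational_funX _ p_shift).
have [A' [B' [Bn0 ABE]]] := rational_funM (ev_shift A) (rational_funV (ev_shift B)).
exists A', B'; split=> //; move: fE => [n0 _ fE].
near=> n.
have <- : ev2 (p n.+1) (r n.+1) A / ev2 (p n.+1) (r n.+1) B =
  ev2 (p n) (r n) A' / ev2 (p n) (r n) B' by near: n.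
apply: fE => /=; apply: leqW; near: n; exact: nbhs_infty_ge.
Unshelve. all: by end_near. Qed.

Lemma near_shift (P : nat -> Prop) : (\forall n \near \oo, P n) ->
  \forall n \near \oo, P n.+1.
Proof. by move=> [n0 _ Pn]; exists n0 => // n /= nn; apply: Pn => /=; apply: leqW. Qed.

(** The two top coefficients of a power of X - a govern the comparison of a relation with its
    shift. *)
Lemma lead_coef_exp_XsubC (a : R) k : (('X - a%:P) ^+ k)`_k = 1.
Proof.
have := monic_exp k (monicXsubC a); rewrite monicE /lead_coef size_exp_XsubC.
by move/eqP.
Qed.

Lemma coef_exp_XsubC (a : R) m : (('X - a%:P) ^+ m.+1)`_m = - (m.+1%:R * a).
Proof.
elim: m => [|m IH]; first by rewrite expr1 coefB coefX coefC /= mul1r sub0r.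
rewrite exprS mulrBl coefB coefXM coefCM /= IH lead_coef_exp_XsubC -[m.+2]addn1 natrD; ring.
Qed.

Definition rational_coefs (F : nat -> {poly R}) :=
  forall i, rational_fun (fun n => (F n)`_i).

Lemma rational_coefsM F H : rational_coefs F -> rational_coefs H ->
  rational_coefs (fun n => F n * H n).
Proof.
move=> hF hH i; under eq_fun do rewrite coefM.
by apply: rational_fun_sum => j; apply: rational_funM.
Qed.

Lemma rational_coefsX F k : rational_coefs F -> rational_coefs (fun n => F n ^+ k).
Proof.
move=> hF; elim: k => [|k IH].
  move=> i; under eq_fun do rewrite expr0 coefC.
  case: (i == 0)%N; [have := rational_fun_rat 1|have := rational_fun_rat 0].
    by rewrite rmorph1.
  by rewrite rmorph0.
under eq_fun do rewrite exprS.
exact: rational_coefsM.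
Qed.

Lemma rational_coefs_XsubC : rational_coefs (fun n => 'X - (p n)%:P).
Proof.
move=> i; under eq_fun do rewrite coefB coefX coefC.
have hN : rational_fun (fun n => - p n).
  have := rational_funM (rational_fun_rat (-1)) rational_fun_p.
  by under eq_fun do rewrite rmorphN rmorph1 mulN1r.
case: i => [|[|i]] /=.
- by under eq_fun do rewrite sub0r.
- by under eq_fun do rewrite subr0; have := rational_fun_rat 1; rewrite rmorph1.
- by under eq_fun do rewrite subr0; have := rational_fun_rat 0; rewrite rmorph0.
Qed.

(* Applied to a monic relation of minimal degree [m], the shift followed by
   subtraction kills the leading term; the next coefficient [g] then satisfies
   [g n.+1 - g n = m (T n - T n.+1)], so [g + m T] is eventually constant. *)
Lemma tail_transcendental m (F : nat -> {poly R}) : rational_coefs F ->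
  (\forall n \near \oo, (size (F n) <= m)%N) ->
  (\forall n \near \oo, (F n).[T n] = 0) ->
  forall i, \forall n \near \oo, (F n)`_i = 0.
Proof.
elim: m F => [|m IH] F Frat Fsz F0 i.
  by apply: filterS Fsz => n; rewrite leqn0 size_poly_eq0 => /eqP ->; rewrite coef0.
have [lc0|lcn0] := rational_fun_dichotomy (Frat m).
  apply: IH => //; apply: filterS2 Fsz lc0 => n sz lc.
  apply/leq_sizeP => j; rewrite leq_eqVlt => /orP[/eqP <- //|mj].
  by rewrite nth_default // (leq_trans sz).
(* What remains is a relation whose coefficient of index [m] is eventually nonzero; this is
   contradictory. *)
exfalso.
pose F' n : {poly R} := ((F n)`_m)^-1 *: F n.
have F'rat : rational_coefs F'.
  move=> j; under eq_fun do rewrite coefZ.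
  by apply: rational_funM (rational_funV (Frat m)) (Frat j).
have F'm : \forall n \near \oo, (F' n)`_m = 1.
  by apply: filterS lcn0 => n lc; rewrite coefZ mulVf.
have F'sz : \forall n \near \oo, (size (F' n) <= m.+1)%N.
  by apply: filterS Fsz => n; apply: leq_trans; apply: size_scale_leq.
have F'0 : \forall n \near \oo, (F' n).[T n] = 0.
  by apply: filterS F0 => n F0n; rewrite hornerZ F0n mulr0.
(* This is F'_{n+1}(X - p_n), which vanishes at T_n because T_{n+1} = T_n - p_n. *)
pose sh n : {poly R} := \sum_(i < m.+1) (F' n.+1)`_i *: ('X - (p n)%:P) ^+ i.
pose H n : {poly R} := sh n - F' n.
have shT : \forall n \near \oo, (sh n).[T n] = 0.
  apply: filterS2 (near_shift F'0) (near_shift F'sz) => n F'0n szn.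
  rewrite -F'0n (horner_coef_wide _ szn) /sh horner_sum; apply: eq_bigr => j _.
  by rewrite hornerZ horner_exp hornerXsubC T_shift.
have sh_coef n j : (sh n)`_j = \sum_(i < m.+1) (F' n.+1)`_i * (('X - (p n)%:P) ^+ i)`_j.
  by rewrite /sh coef_sum; apply: eq_bigr => k _; rewrite coefZ.
have Hrat : rational_coefs H.
  move=> j; under eq_fun do rewrite coefB sh_coef.
  apply: rational_funD.
    apply: rational_fun_sum => k; apply: rational_funM.
      exact: (rational_fun_shift (F'rat k)).
    exact: (rational_coefsX _ rational_coefs_XsubC).
  have := rational_funM (rational_fun_rat (-1)) (F'rat j).
  by under eq_fun do rewrite rmorphN rmorph1 mulN1r.
have hi0 (a : R) k j : (k < j)%N -> (('X - a%:P) ^+ k)`_j = 0.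
  by move=> kj; rewrite nth_default // size_exp_XsubC.
have Hsz : \forall n \near \oo, (size (H n) <= m)%N.
  near=> n; apply/leq_sizeP => j; rewrite /H coefB sh_coef.
  rewrite leq_eqVlt => /orP[/eqP <-|mj].
    rewrite big_ord_recr /= big1 ?add0r => [|k _]; last first.
      by rewrite hi0 ?mulr0.
    rewrite lead_coef_exp_XsubC mulr1.
    have -> : (F' n)`_m = 1 by near: n.
    have -> : (F' n.+1)`_m = 1 by near: n; apply: near_shift F'm.
    by rewrite subrr.
  rewrite big1 => [|k _]; last first.
    by rewrite hi0 ?mulr0 // (leq_trans _ mj).
  rewrite nth_default ?subrr //; apply: leq_trans mj.
  by near: n.
have HT : \forall n \near \oo, (H n).[T n] = 0.
  by apply: filterS2 shT F'0 => n s0 f0; rewrite hornerD hornerN s0 f0 subrr.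
have H0 := IH H Hrat Hsz HT.
(* In degree 0 the monic relation is the constant 1, which has no root. *)
case: m {IH} => [|m] in F' F'rat F'm F'sz F'0 sh H shT sh_coef Hrat Hsz HT H0 Fsz lcn0 *.
  have [n _ /(_ n (leqnn n)) /=[sz c1 c0]] : \forall n \near \oo,
      [/\ (size (F' n) <= 1)%N, (F' n)`_0 = 1 & (F' n).[T n] = 0].
    by apply: filterS3 F'sz F'm F'0.
  move: c0; rewrite (size1_polyC sz) hornerC c1 => /eqP.
  by rewrite oner_eq0.
pose g n := (F' n)`_m.
have gE : \forall n \near \oo, g n.+1 + m.+1%:R * T n.+1 = g n + m.+1%:R * T n.
  apply: filterS2 (H0 m) (near_shift F'm) => n; rewrite coefB sh_coef.
  rewrite big_ord_recr big_ord_recr /= big1 ?add0r => [|k _]; last first.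
    by rewrite hi0 ?mulr0.
  rewrite lead_coef_exp_XsubC mulr1 coef_exp_XsubC T_shift /g => h0 lcE; rewrite lcE in h0.
  by rewrite -(subr0_eq h0) mul1r; ring.
case: gE => n0 _ gE.
pose kappa := g n0 + m.+1%:R * T n0.
have gk n : (n0 <= n)%N -> g n + m.+1%:R * T n = kappa.
  elim: n => [|n IHn]; first by rewrite leqn0 => /eqP <-.
  rewrite leq_eqVlt => /orP[/eqP <- //|nn].
  by rewrite gE //= IHn.
have g_cvg : g n @[n --> \oo] --> kappa.
  have : kappa - m.+1%:R * T n @[n --> \oo] --> kappa - m.+1%:R * 0.
    by apply: cvgB; [exact: cvg_cst|apply: cvgM => //; exact: cvg_cst].
  rewrite mulr0 subr0; apply: cvg_trans; apply: near_eq_cvg.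
  by exists n0 => // n /= nn; rewrite -(gk _ nn) addrK.
(* As a limit of a rational function, [kappa] is rational. So is [g n] for large [n], since p_n and
   r_n are rational numbers; hence T_n would be rational. *)
have [c kc] := rational_fun_lim (F'rat m) g_cvg.
have [A [B [_ [n1 _ gAB]]]] := F'rat m.
pose n := maxn n0 n1.
have [a Aa] := ev2_rat n A; have [b Bb] := ev2_rat n B.
apply: (@T_irrational n ((c - a / b) / m.+1%:R)).
rewrite rmorphM rmorphB /= !fmorph_div /= fmorphV rmorph_nat -kc -(gk n) ?leq_maxl //.
rewrite -Aa -Bb -gAB /= ?leq_maxr // -/(g n) [g n + _]addrC addrK.
by rewrite mulrC mulKf // pnatr_eq0.
Unshelve. all: by end_near. Qed.

End AlgebraicIndependence.
End MonomialAsymptotics.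

(** * Integrality and growth of the sequence *)

Lemma sqr_sub4_not_square (d t : nat) : (3 <= d)%N -> (t ^ 2 != d ^ 2 - 4)%N.
Proof.
move=> d3; apply/eqP => t2; have td : (t < d)%N.
  by rewrite -(@ltn_exp2r _ _ 2) // t2; nia.
(* With h = k + 1 the equation reads 2 t h + h^2 = 4, whose only solution t = 0, h = 2 gives d =
   2. *)
have [k kE] : exists k, d = (t.+1 + k)%N by exists (d - t.+1)%N; lia.
move: t2; rewrite kE -!mulnn; have [t1|t1] := leqP t 1; nia.
Qed.

Section RecurrenceSequence.
Variables (R : realType) (d1 d2 : nat) (G : {poly int}) (x : nat -> R).
Hypothesis hd1 : (3 <= d1)%N.
Hypothesis hGnonneg : forall i : nat, 0 <= G`_i.
Hypothesis hGdeg : size G = d2.+1.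
Hypothesis hG0 : G.[0] != 0.
Hypothesis hG1 : 3 <= G.[1].
Hypothesis hx0 : x 0%N = 1.
Hypothesis hx1 : x 1%N = 1.
Hypothesis hxrec : forall n : nat,
  x n.+2 * x n = x n.+1 ^+ d1 * (map_poly intr G).[x n.+1].

Let gR (y : R) := (map_poly intr G).[y].

Lemma gR_sum y : gR y = \sum_(i < d2.+1) (G`_i)%:~R * y ^+ i.
Proof.
rewrite /gR (@horner_coef_wide _ d2.+1) -?hGdeg ?size_poly //.
by apply: eq_bigr => i _; rewrite coef_map.
Qed.

Lemma G_nat (k : nat) : exists2 m : nat, (0 < m)%N & gR k%:R = m%:R.
Proof.
have G0 : 0 < G`_0.
  by rewrite lt_neqAle hGnonneg andbT eq_sym -horner_coef0.
have Gk : 0 < G.[k%:R].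
  rewrite horner_coef hGdeg big_ord_recl expr0 mulr1.
  by apply: ltr_wpDr => //; apply: sumr_ge0 => i _; rewrite mulr_ge0 ?exprn_ge0.
exists `|G.[k%:R]|%N; first by rewrite absz_gt0 gt_eqF.
rewrite natr_absz gtr0_norm // /gR -[k%:R in LHS](rmorph_nat (intr : {rmorphism int -> R})).
by rewrite horner_map.
Qed.

(** Integrality needs the square divisibility in the induction. If x_n = k and x_{n+1} = j = k^2 m,
    then j^d1 / k = j^2 j^(d1-3) (k m), where [3 <= d1] supplies the three factors j; so x_{n+2} is
    an integer divisible by j^2. *)
Lemma x_pair_nat n : exists k m : nat,
  [/\ (0 < k)%N, (0 < m)%N, x n = k%:R & x n.+1 = (k ^ 2 * m)%:R].
Proof.
elim: n => [|n [k [m [k0 m0 xk xm]]]].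
  by exists 1%N, 1%N; rewrite hx0 hx1.
set j := (k ^ 2 * m)%N in xm.
have j0 : (0 < j)%N by rewrite /j muln_gt0 expn_gt0 k0.
have [g g0 gE] := G_nat j.
exists j, (j ^ (d1 - 3) * (k * m) * g)%N; split=> //.
  by rewrite !muln_gt0 expn_gt0 j0 k0 m0.
have kn0 : x n != 0 by rewrite xk pnatr_eq0 -lt0n.
apply: (mulIf kn0); rewrite hxrec xm -/(gR _) gE xk -!natrX -!natrM; congr _%:R.
have -> : d1 = (d1 - 3 + 2 + 1)%N by lia.
rewrite !expnD expn1 {4}/j; have -> : (d1 - 3 + 2 + 1 - 3 = d1 - 3)%N by lia.
by rewrite {3}/j; nia.
Qed.

Lemma x_nat : exists a : nat -> nat,
  [/\ forall n, x n = (a n)%:R, forall n, (0 < a n)%N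
    & forall n, (a n ^ 2 %| a n.+1)%N].
Proof.
have ex n : exists k : nat, (0 < k)%N /\ x n = k%:R.
  by have [k [m [? ? ? ?]]] := x_pair_nat n; exists k.
have [a Ha] := choice ex; exists a; split=> [n|n|n]; try by case: (Ha n).
have [k [m [_ _ xk xm]]] := x_pair_nat n.
have [_ xa] := Ha n; have [_ xa'] := Ha n.+1.
move: xk xm; rewrite xa xa' => /eqP; rewrite eqr_nat => /eqP -> /eqP.
by rewrite eqr_nat => /eqP ->; apply: dvdn_mulr.
Qed.

Lemma x_ge1 n : 1 <= x n.
Proof. by have [a [-> a0 _]] := x_nat; rewrite ler1n. Qed.

Lemma x_pos n : 0 < x n. Proof. exact: lt_le_trans (x_ge1 n). Qed.
Hint Resolve x_pos x_ge1 : core.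

Lemma x_sqr_le n : x n ^+ 2 <= x n.+1.
Proof.
have [a [aE a0 ad]] := x_nat; rewrite !aE -natrX ler_nat.
exact: dvdn_leq.
Qed.

Lemma x_le_succ n : x n <= x n.+1.
Proof. by apply: le_trans (x_sqr_le n); rewrite expr2 ler_peMl // ltW. Qed.

Lemma x2_ge3 : 3 <= x 2%N.
Proof.
have := hxrec 0; rewrite hx0 hx1 mulr1 expr1n mul1r => ->.
rewrite -[1](rmorph1 (intr : {rmorphism int -> R})) horner_map /=.
by rewrite -[3]/(3%:~R) ler_int.
Qed.

Lemma x_ge_n n : (n.+3)%:R <= x n.+2.
Proof.
elim: n => [|n IH]; first exact: x2_ge3.
apply: le_trans (x_sqr_le _); rewrite expr2.
have x3 : 3 <= x n.+2 by apply: le_trans IH; rewrite ler_nat.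
have : 3 * x n.+2 <= x n.+2 * x n.+2 by rewrite ler_wpM2r // ltW.
by move: IH; rewrite -[n.+4]addn1 natrD; lra.
Qed.

Lemma x_cvg : x n @[n --> \oo] --> +oo.
Proof.
apply/cvgryPge => A; near=> n.
have n2 : (2 <= n)%N by near: n; apply: nbhs_infty_ge.
have An : A <= n%:R.
  near: n; have /cvgryPge := @cvgr_idn R; exact.
apply: le_trans An _; have := x_ge_n n.-2.
have -> : (n.-2).+2 = n by lia.
by apply: le_trans; rewrite ler_nat; lia.
Unshelve. all: by end_near. Qed.

Lemma x_double n : (0 < n)%N -> 2 * x n <= x n.+1.
Proof.
case: n => // -[_|n _]; first by rewrite hx1; have := x2_ge3; lra.
apply: le_trans (x_sqr_le _); rewrite expr2 ler_wpM2r //; first exact: ltW.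
by apply: le_trans (x_ge_n n); rewrite ler_nat.
Qed.

Lemma gR_ge y : 1 <= y -> y ^+ d2 <= gR y.
Proof.
move=> y1; rewrite gR_sum big_ord_recr /=.
have y0 : 0 <= y by apply: le_trans y1.
apply: ler_wpDl; first by apply: sumr_ge0 => i _; rewrite mulr_ge0 ?exprn_ge0 ?ler0z.
apply: ler_peMl; first exact: exprn_ge0.
have : 0 < G`_d2.
  rewrite lt_neqAle hGnonneg andbT eq_sym.
  have -> : G`_d2 = lead_coef G by rewrite /lead_coef hGdeg.
  by rewrite lead_coef_eq0 -size_poly_eq0 hGdeg.
by rewrite -[1 in leLHS]/(1%:~R) ler_int gtz0_ge1.
Qed.

Lemma gR_le y : 1 <= y -> gR y <= (G.[1])%:~R * y ^+ d2.
Proof.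
move=> y1; rewrite gR_sum horner_coef hGdeg rmorph_sum mulr_suml.
apply: ler_sum => i _; rewrite expr1n mulr1 ler_wpM2l ?ler0z //.
by rewrite ler_weXn2l // -ltnS ltn_ord.
Qed.

Lemma x_succ_le n : x n.+1 <= (G.[1])%:~R * x n ^+ (d1 + d2).
Proof.
have G1 : 1 <= (G.[1])%:~R :> R.
  by rewrite -[1]/(1%:~R) ler_int; lia.
case: n => [|n]; first by rewrite hx0 hx1 expr1n mulr1.
have : x n.+2 <= x n.+2 * x n by rewrite ler_peMr // ltW.
move/le_trans; apply; rewrite hxrec exprD mulrCA; apply: ler_wpM2l.
  by rewrite exprn_ge0 // ltW.
exact: gR_le.
Qed.

(** * Logarithmic growth and the irrational growth exponent *)

Let l n := ln (x n).
Let d := (d1 + d2)%N.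

(** Logarithms of the recurrence, with y^d2 <= G(y) <= G(1) y^d2 for y >= 1, give a linear
    recurrence up to a bounded error. *)
Lemma l_recurrence n :
  0 <= l n.+2 + l n - d%:R * l n.+1 <= ln ((G.[1])%:~R : R).
Proof.
have G1 : 0 < (G.[1])%:~R :> R by rewrite ltr0z; lia.
have xd : 0 < x n.+1 ^+ d by rewrite exprn_gt0.
have -> : l n.+2 + l n = ln (x n.+1 ^+ d1 * gR (x n.+1)).
  by rewrite -hxrec lnM ?posrE.
have -> : d%:R * l n.+1 = ln (x n.+1 ^+ d).
  by rewrite lnXn // mulr_natl.
have dE : x n.+1 ^+ d = x n.+1 ^+ d1 * x n.+1 ^+ d2 by rewrite exprD.
have x1 : 0 < x n.+1 ^+ d1 by rewrite exprn_gt0.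
have g0 : 0 < gR (x n.+1) by apply: lt_le_trans (gR_ge _); rewrite ?exprn_gt0.
rewrite subr_ge0 ler_ln ?posrE ?mulr_gt0 //.
rewrite {1}dE ler_wpM2l ?gR_ge ?(ltW x1) //=.
rewrite lerBlDr -lnM ?posrE // ler_ln ?posrE ?mulr_gt0 // dE mulrCA.
by rewrite ler_wpM2l ?gR_le ?(ltW x1).
Qed.

(** The larger root of t^2 - d t + 1, the characteristic polynomial of that linear recurrence. *)
Let lam : R := (d%:R + Num.sqrt (d%:R ^+ 2 - 4)) / 2.

Lemma d_ge3 : 3 <= d%:R :> R.
Proof. by rewrite ler_nat /d; lia. Qed.

Lemma lam_eq : lam ^+ 2 = d%:R * lam - 1.
Proof.
have s2 : Num.sqrt (d%:R ^+ 2 - 4) ^+ 2 = d%:R ^+ 2 - 4 :> R.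
  by rewrite sqr_sqrtr //; have := d_ge3; nra.
by rewrite /lam; field: s2.
Qed.

Lemma lam_ge2 : 2 <= lam.
Proof.
have s1 : 1 <= Num.sqrt (d%:R ^+ 2 - 4) :> R.
  by rewrite -[1 in leLHS]sqrtr1 ler_sqrt; have := d_ge3; nra.
by rewrite /lam; have := d_ge3; lra.
Qed.

(** The other root being 1/lam, the difference u_n = l_{n+1} - lam l_n satisfies u_{n+1} = u_n / lam
    + e with 0 <= e <= ln G(1). As lam >= 2, the bound 2 ln G(1) reproduces itself. *)
Lemma l_ratio n : `|l n.+1 - lam * l n| <= 2 * ln ((G.[1])%:~R : R).
Proof.
have L0 : 0 <= ln ((G.[1])%:~R : R).
  by apply: ln_ge0; rewrite -[1]/(1%:~R) ler_int; lia.
elim: n => [|n IH]; first by rewrite /l hx0 hx1 ln1 mulr0 subr0 normr0 mulr_ge0.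
have /andP[e0 e1] := l_recurrence n.
set e := l n.+2 + l n - d%:R * l n.+1 in e0 e1.
have l2 := lam_ge2; have lE := lam_eq.
have lam0 : lam != 0 by rewrite gt_eqF //; lra.
have -> : l n.+2 - lam * l n.+1 = (l n.+1 - lam * l n) / lam + e.
  apply: (mulIf lam0); rewrite [RHS]mulrDl divfK // /e.
  have -> : (l n.+2 - lam * l n.+1) * lam = l n.+2 * lam - lam ^+ 2 * l n.+1 by ring.
  by rewrite lE; ring.
apply: le_trans (ler_normD _ _) _; rewrite [`|e|]ger0_norm //.
rewrite normrM normfV [`|lam|]ger0_norm; last lra.
have : `|l n.+1 - lam * l n| / lam <= ln ((G.[1])%:~R : R).
  by rewrite ler_pdivrMr; [nra|lra].
by lra.
Qed.

Lemma l_cvg : l n @[n --> \oo] --> +oo.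
Proof.
apply/cvgryPge => A; move/cvgryPge: x_cvg => /(_ (expR A)).
by apply: filterS => n xA; rewrite -[A]expRK ler_ln ?posrE ?expR_gt0.
Qed.

(** The quadratic equation gives (2n - d m)^2 = (d^2 - 4) m^2, so a nonzero [m] would make d^2 - 4 a
    perfect square. *)
Lemma lam_irrational (m n : int) : m%:~R * lam = n%:~R -> m = 0.
Proof.
move=> mn; apply: contrapT => /eqP m0.
have E : n ^+ 2 = d%:Z * (n * m) - m ^+ 2.
  have nR : n%:~R ^+ 2 = d%:R * (n%:~R * m%:~R) - m%:~R ^+ 2 :> R.
    by rewrite -mn exprMn lam_eq; ring.
  by apply: (@intr_inj R); rewrite rmorphXn /= nR rmorphB !rmorphM /= expr2.
have E2 : (2 * n - d%:Z * m) ^+ 2 = (d%:Z ^+ 2 - 4) * m ^+ 2.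
  have -> : (2 * n - d%:Z * m) ^+ 2 = 4 * n ^+ 2 - 4 * d%:Z * (n * m) + d%:Z ^+ 2 * m ^+ 2 by ring.
  by rewrite E; ring.
have d3 : (3 <= d)%N by rewrite /d; lia.
pose u := 2 * n - d%:Z * m.
have E3 : (`|u| ^ 2 = (d ^ 2 - 4) * `|m| ^ 2)%N.
  rewrite -!abszX [(2 * n - d%:Z * m) ^+ 2]E2 abszM; congr (_ * _)%N.
  by lia.
have md : (`|m| %| `|u|)%N.
  by rewrite -(@dvdn_pexp2r _ _ 2) // E3 dvdn_mull.
have /dvdnP[t tE] := md.
move: E3; rewrite tE expnMn => /eqP; rewrite eqn_pmul2r ?expn_gt0 ?absz_gt0 ?m0 //.
by rewrite (negPf (sqr_sub4_not_square t d3)).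
Qed.

(** Equal weights mean ((i + k) - (i' + k')) lam = k - k', and irrationality of [lam] makes both
    sides vanish. *)
Lemma weight_inj_lam i k i' k' : weight lam i k = weight lam i' k' ->
  i = i' /\ k = k'.
Proof.
rewrite /weight => E.
have E1 : ((i + k)%:Z - (i' + k')%:Z)%:~R * lam = (k%:Z - k'%:Z)%:~R.
  rewrite !rmorphB /= -!pmulrn !natrD; apply/eqP; rewrite -subr_eq0; apply/eqP.
  by rewrite -(subrr (i%:R * lam + k%:R * (lam - 1))) {2}E; ring.
have m0 := lam_irrational E1; move: E1; rewrite m0 mul0r => /esym/eqP.
by rewrite intr_eq0 => /eqP; lia.
Qed.

(** * Convergence and irrationality of the sum *)

Lemma recip_psumS n : recip_psum x n.+1 = recip_psum x n + (x n.+1)^-1.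
Proof. by rewrite /recip_psum big_nat_recr. Qed.

Lemma recip_psum0 : recip_psum x 0 = 0.
Proof. by rewrite /recip_psum big_geq. Qed.

Lemma recip_psum_le n m : (n <= m)%N -> recip_psum x n <= recip_psum x m.
Proof.
move=> /subnKC <-; elim: (m - n)%N => [|k IH]; first by rewrite addn0.
by rewrite addnS recip_psumS; apply: le_trans IH _; rewrite lerDl invr_ge0 ltW.
Qed.

(** Since x_{k+2} >= 2 x_{k+1}, the partial sum up to k plus 2 / x_{k+1} is nonincreasing in k. *)
Lemma recip_psum_ub n m : recip_psum x m <= recip_psum x n + 2 / x n.+1.
Proof.
have step k : recip_psum x k.+1 + 2 / x k.+2 <= recip_psum x k + 2 / x k.+1.
  have : 2 / x k.+2 <= (x k.+1)^-1.
    by rewrite ler_pdivrMr // mulrC ler_pdivlMr // x_double.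
  by rewrite recip_psumS; lra.
have inv k : 0 <= 2 / x k.+1 by rewrite divr_ge0 // ltW.
have [/recip_psum_le mn|/ltnW/subnKC <-] := leqP m n.
  by have := inv n; lra.
apply: (@le_trans _ _ (recip_psum x (n + (m - n)) + 2 / x (n + (m - n)).+1)).
  by rewrite lerDl.
elim: (m - n)%N => [|k IH]; first by rewrite addn0.
by rewrite addnS; apply: le_trans (step _) IH.
Qed.

Lemma recip_psum_cvg : cvgn (recip_psum x).
Proof.
apply: nondecreasing_is_cvgn; first exact: recip_psum_le.
exists (recip_psum x 0 + 2 / x 1%N) => _ [n _ <-].
exact: recip_psum_ub.
Qed.

Let S := limn (recip_psum x).
Let T n := S - recip_psum x n.
Let p n := (x n.+1)^-1.
Let r n := x n / x n.+1.

Lemma T_shift n : T n.+1 = T n - p n.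
Proof. by rewrite /T recip_psumS opprD addrA. Qed.

Lemma T_gt0 n : 0 < T n.
Proof.
rewrite subr_gt0; apply: (@lt_le_trans _ _ (recip_psum x n.+1)).
  by rewrite recip_psumS ltrDl invr_gt0.
by apply: nondecreasing_cvgn_le; [exact: recip_psum_le|exact: recip_psum_cvg].
Qed.

Lemma T_le n : T n <= 2 / x n.+1.
Proof.
rewrite lerBlDl; apply: limr_le; first exact: recip_psum_cvg.
by apply: nearW => m; apply: recip_psum_ub.
Qed.

Lemma T_cvg0 : T n @[n --> \oo] --> (0 : R).
Proof.
rewrite -(subrr S); apply: cvgB; [exact: cvg_cst|exact: recip_psum_cvg].
Qed.

Lemma x_pow_le n k : x n ^+ k.+1 <= x (n + k).
Proof.
elim: k => [|k IH]; first by rewrite addn0 expr1.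
rewrite addnS exprSr; apply: le_trans (x_sqr_le _); rewrite expr2.
have xn : x n <= x (n + k) by apply: le_trans IH; rewrite ler_eXnr.
have x0 := ltW (x_pos n).
by apply: ler_pM => //; apply: exprn_ge0.
Qed.

(** Along the divisibility chain x_n is a common denominator of all terms up to index n. *)
Lemma x_recip_psum_int n : exists k : int, x n * recip_psum x n = k%:~R.
Proof.
elim: n => [|n [k kE]]; first by exists 0; rewrite recip_psum0 mulr0.
have [a [m [_ _ xa xm]]] := x_pair_nat n.
exists (k * (a * m)%:Z + 1).
rewrite recip_psumS mulrDr divff ?gt_eqF // rmorphD /= rmorphM /= -kE.
by rewrite xm xa -pmulrn !natrM; congr (_ + _); ring.
Qed.

(** If [D] is the denominator of S, then D x_n T_n is a positive integer, yet T_n <= 2 / x_{n+1} <=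
    2 / x_n^2 bounds it by 2 D / x_n. *)
Lemma S_irrational (c : rat) : S <> ratr c.
Proof.
move=> Sc; pose D := `|denq c|%N.
have D0 : (0 < D)%N by rewrite absz_gt0 denq_eq0.
have DS : D%:R * S = (numq c)%:~R.
  rewrite Sc /ratr mulrCA natr_absz ger0_norm ?denq_ge0 // divff ?mulr1 //.
  by rewrite intr_eq0 denq_eq0.
have big n : 1 <= D%:R * (x n * T n).
  have [k kE] := x_recip_psum_int n; have [a [m [a0 _ xa _]]] := x_pair_nat n.
  have : 0 < D%:R * (x n * T n) by rewrite !mulr_gt0 ?ltr0n // T_gt0.
  have -> : D%:R * (x n * T n) = (a%:Z * numq c - D%:Z * k)%:~R.
    by rewrite rmorphB !rmorphM /= -DS -kE -!pmulrn -xa /T; ring.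
  by rewrite ltr0z -[1 in leLHS]/(1%:~R) ler_int gtz0_ge1.
have small n : D%:R * (x n * T n) * x n <= 2 * D%:R.
  have xT : x n * T n * x n <= 2.
    have := T_le n; rewrite ler_pdivlMr // => xT.
    have := ler_wpM2l (ltW (T_gt0 n)) (x_sqr_le n).
    rewrite expr2 => h; apply: le_trans xT; apply: le_trans h.
    by rewrite le_eqVlt; apply/orP; left; apply/eqP; ring.
  by rewrite -!mulrA [X in _ <= X]mulrC ler_wpM2l // mulrA.
move/cvgryPge: x_cvg => /(_ (2 * D%:R + 1))[n _ /(_ n (leqnn n)) xn].
have := le_trans (ler_wpM2r (ltW (x_pos n)) (big n)) (small n).
by move: xn => /=; lra.
Qed.

Lemma p_rat n : exists c, p n = ratr c.
Proof.
have [k [_ [_ _ xk _]]] := x_pair_nat n.+1.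
by exists k%:R^-1; rewrite fmorphV rmorph_nat /p xk.
Qed.

Lemma r_rat n : exists c, r n = ratr c.
Proof.
have [k [_ [_ _ xk _]]] := x_pair_nat n.
have [k' [_ [_ _ xk' _]]] := x_pair_nat n.+1.
by exists (k%:R / k'%:R); rewrite fmorph_div /= !rmorph_nat /r xk xk'.
Qed.

Lemma recip_psum_rat n : exists c, recip_psum x n = ratr c.
Proof.
elim: n => [|n [c cE]]; first by exists 0; rewrite recip_psum0 rmorph0.
have [c' pE] := p_rat n; exists (c + c').
by rewrite recip_psumS cE -/(p n) pE rmorphD.
Qed.

Lemma T_irrational n c : T n <> ratr c.
Proof.
move=> Tc; have [c' cE] := recip_psum_rat n.
by apply: (@S_irrational (c + c')); rewrite rmorphD /= -Tc -cE /T subrK.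
Qed.

(** * Recurrence for p_n and r_n, and expansion of the tail *)

Let Grev : {poly rat} := \poly_(i < d2.+1) (G`_(d2 - i))%:~R.
Let Gp n : R := (map_poly ratr Grev).[p n].

(** Reversing the coefficients moves the behaviour of G at infinity to 0. Thus [Gp n] is G(x_{n+1})
    / x_{n+1}^d2, a polynomial in p_n whose constant term is the leading coefficient of G. *)
Lemma Grev_horner y : 0 < y -> gR y = y ^+ d2 * (map_poly ratr Grev).[y^-1].
Proof.
move=> y0; rewrite gR_sum (@horner_coef_wide _ d2.+1); last first.
  by rewrite size_map_poly size_poly.
rewrite mulr_sumr (reindex_inj rev_ord_inj); apply: eq_bigr => i _ /=.
rewrite coef_map /= coef_poly ltn_ord ratr_int subSS mulrCA; congr (_ * _).
have id : (i <= d2)%N by rewrite -ltnS.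
rewrite -[in y ^+ d2](subnK id) exprD -mulrA -exprMn divff ?gt_eqF //.
by rewrite expr1n mulr1.
Qed.

Lemma Gp_ge1 n : 1 <= Gp n.
Proof.
have xd : 0 < x n.+1 ^+ d2 by rewrite exprn_gt0.
by rewrite -(ler_pM2l xd) mulr1 -Grev_horner // gR_ge.
Qed.

(** The recurrence reads x_{n+2} = x_{n+1}^d Gp_n / x_n. With [p_rec] it makes the shift of (p, r) a
    rational map that is regular at the origin. *)
Lemma r_rec n : r n.+1 = p n ^+ (d - 2) * r n * (Gp n)^-1.
Proof.
have Gn0 : Gp n != 0 by rewrite gt_eqF // (lt_le_trans _ (Gp_ge1 n)).
have x0 : x n != 0 by rewrite gt_eqF.
have x1 : x n.+1 != 0 by rewrite gt_eqF.
have x2 : x n.+2 = x n.+1 ^+ (d - 2) * x n.+1 ^+ 2 * Gp n / x n.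
  apply: (mulIf x0); rewrite divfK // hxrec -/(gR _) Grev_horner // mulrA -!exprD.
  by congr (_ ^+ _ * _); rewrite /d; lia.
rewrite /r x2 /p exprVn.
have xd : x n.+1 ^+ (d - 2) != 0 by rewrite expf_neq0.
by field; rewrite x0 x1 Gn0 xd.
Qed.

Lemma p_rec n : p n.+1 = p n * r n.+1.
Proof. by rewrite /p /r mulrA mulVf ?mul1r // gt_eqF. Qed.

Lemma p_bound n : 0 <= p n <= (x n)^-1.
Proof. by rewrite invr_ge0 ltW //= lef_pV2 ?posrE // x_le_succ. Qed.

Lemma r_bound n : 0 <= r n <= (x n)^-1.
Proof.
apply/andP; split; first by rewrite divr_ge0 // ltW.
by rewrite ler_pdivrMr // ler_pdivlMl // -expr2 x_sqr_le.
Qed.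

(** As Grev(0) is nonzero, there is a Bezout relation U Grev + V X^M = 1. Here U serves as a
    truncated inverse series, with error V(p_n) p_n^M / Gp_n. *)
Lemma has_expansion_Gp_inv : has_expansion x p r (fun n => (Gp n)^-1).
Proof.
have hp := has_expansion_p x p r.
apply: has_expansion_approx => M.
have cop : coprimep Grev 'X^M.
  apply: coprimep_expr; rewrite -['X]subr0 -polyC0 coprimep_XsubC.
  rewrite /root horner_coef0 coef_poly /= subn0 intr_eq0.
  have -> : G`_d2 = lead_coef G by rewrite /lead_coef hGdeg.
  by rewrite lead_coef_eq0 -size_poly_eq0 hGdeg.
have /Bezout_eq1_coprimepP[[U V] /= UV] := cop.
exists (fun n => (map_poly ratr U).[p n]).
  exact: has_expansion_horner x_ge1 p_bound r_bound _ _ hp.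
have V0 := has_expansion_bigOx x_ge1 p_bound r_bound
  (has_expansion_horner x_ge1 p_bound r_bound V hp).
have pM := @bigOxX _ x 1 M p (bigOx_p p_bound).
have GV0 : bigOx x 0 (fun n => (Gp n)^-1).
  exists 1; apply: nearW => n; rewrite expr0 mulr1 normfV ger0_norm.
    by rewrite invf_le1 ?Gp_ge1 // (lt_le_trans _ (Gp_ge1 n)).
  by rewrite (le_trans _ (Gp_ge1 n)).
have := bigOxM (bigOxM V0 pM) GV0; rewrite add0n addn0 muln1.
congr bigOx; apply/funext => n.
have Gn0 : Gp n != 0 by rewrite gt_eqF // (lt_le_trans _ (Gp_ge1 n)).
have := congr1 (fun P => (map_poly (ratr : rat -> R) P).[p n]) UV.
rewrite rmorphD !rmorphM /= map_polyXn hornerD !hornerM hornerXn rmorph1 hornerC -/(Gp n).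
move=> E; apply: (mulIf Gn0); rewrite divfK // mulrBl mulVf // -E.
by rewrite addrAC subrr add0r.
Qed.

(** Substituting the expansions of p_{n+1} and r_{n+1} into the polynomial for f works, because the
    error O(x_{n+1}^-M) is also O(x_n^-M). *)
Lemma has_expansion_shift f : has_expansion x p r f ->
  has_expansion x p r (fun n => f n.+1).
Proof.
have hp := has_expansion_p x p r; have hr := has_expansion_r x p r.
have hr' : has_expansion x p r (fun n => r n.+1).
  under eq_fun do rewrite r_rec.
  apply: (has_expansionM x_ge1 p_bound r_bound _ has_expansion_Gp_inv).
  apply: (has_expansionM x_ge1 p_bound r_bound _ hr).
  exact: (has_expansionX x_ge1 p_bound r_bound).
have hp' : has_expansion x p r (fun n => p n.+1).
  under eq_fun do rewrite p_rec.
  exact: (has_expansionM x_ge1 p_bound r_bound).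
move=> hf; apply: has_expansion_approx => M; have [Q [C [n0 _ fQ]]] := hf M.
exists (fun n => ev2 (p n.+1) (r n.+1) Q).
  exact: (has_expansion_ev2_comp x_ge1 p_bound r_bound).
exists `|C|; exists n0 => // n /= nn.
apply: le_trans (fQ n.+1 _) _; first by rewrite /= leqW.
apply: le_trans (ler_wpM2r _ (ler_norm C)) _.
  by rewrite exprn_ge0 // invr_ge0 ltW.
apply: ler_wpM2l => //.
apply: lerXn2r; rewrite ?nnegrE ?invr_ge0; [exact: ltW|exact: ltW|].
by rewrite lef_pV2 ?posrE // x_le_succ.
Qed.

(** T_n is the sum of p_{n+j} over j < M plus T_{n+M}. The terms are iterated shifts of p, and
    T_{n+M} <= 2 / x_{n+M+1} is O(x_n^-M) because each x_n is at least the square of its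
    predecessor. *)
Lemma has_expansion_T : has_expansion x p r T.
Proof.
have hpj j : has_expansion x p r (fun n => p (n + j)).
  elim: j => [|j IH].
    by under eq_fun do rewrite addn0; apply: has_expansion_p.
  by under eq_fun do rewrite addnS -addSn; apply: (has_expansion_shift IH).
have TE n M : T (n + M) = T n - \sum_(j < M) p (n + j).
  elim: M => [|M IH]; first by rewrite big_ord0 subr0 addn0.
  by rewrite addnS T_shift IH big_ord_recr /= opprD addrA.
apply: has_expansion_approx => M; exists (fun n => \sum_(j < M) p (n + j)).
  by apply: has_expansion_sum => j; apply: hpj.
exists 2; apply: nearW => n; rewrite -TE gtr0_norm ?T_gt0 //.
apply: le_trans (T_le _) _; rewrite ler_wpM2l // exprVn.
rewrite lef_pV2 ?posrE ?exprn_gt0 // -addnS.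
by apply: le_trans (x_pow_le _ _); rewrite ler_weXn2l // !leqW.
Qed.

(** * Nonvanishing of the auxiliary values *)

Lemma p_exp n : p n = expR (- l n.+1).
Proof. by rewrite expRN lnK ?posrE. Qed.

Lemma r_exp n : r n = expR (l n - l n.+1).
Proof. by rewrite expRD expRN !lnK ?posrE. Qed.

Lemma r_shift_rational : rational_fun p r (fun n => r n.+1).
Proof.
under eq_fun do rewrite r_rec.
have hG : rational_fun p r Gp.
  rewrite /Gp; under eq_fun do rewrite horner_coef size_map_poly.
  apply: (rational_fun_sum p_exp r_exp l_cvg l_ratio weight_inj_lam) => i.
  rewrite coef_map; apply: rational_funM; first exact: rational_fun_rat.
  exact/rational_funX/rational_fun_p.
apply: rational_funM (rational_funV hG).
apply: rational_funM (rational_fun_r _ _).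
exact/rational_funX/rational_fun_p.
Qed.

Lemma p_shift_rational : rational_fun p r (fun n => p n.+1).
Proof.
under eq_fun do rewrite p_rec.
exact: rational_funM (rational_fun_p _ _) r_shift_rational.
Qed.

(** Grouped by powers of T, an eventually vanishing value is a relation [F] for T_n, so
    [tail_transcendental] kills each of its coefficients. The one at the exponent [t0.2] is a
    nonzero polynomial in p_n and r_n, against [ev2_neq0]. *)
Lemma auxiliary_value_nonzero N (c : 'I_N.+1 * 'I_N.+1 * 'I_N.+1 -> rat) t0 :
  c t0 != 0 -> ~ \forall n \near \oo,
    \sum_t ratr (c t) * p n ^+ t.1.1 * r n ^+ t.1.2 * T n ^+ t.2 = 0.
Proof.
move=> ct0 E0.
pose F n : {poly R} := \sum_t (ratr (c t) * p n ^+ t.1.1 * r n ^+ t.1.2) *: 'X^(t.2).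
(* [Q] keeps the terms with the same power of T as [t0]. *)
pose Q : {poly {poly rat}} :=
  \sum_t ((c t * (t0.2 == t.2)%:R)%:P * 'X ^+ t.1.1)%:P * 'X ^+ t.1.2.
have FE i n : (F n)`_i =
    \sum_t ratr (c t) * p n ^+ t.1.1 * r n ^+ t.1.2 * (i == t.2)%:R.
  by rewrite /F coef_sum; apply: eq_bigr => t _; rewrite coefZ coefXn.
have FQ n : (F n)`_(t0.2) = ev2 (p n) (r n) Q.
  rewrite FE rmorph_sum; apply: eq_bigr => t _.
  rewrite polyCM polyC_exp !(rmorphM (ev2 _ _)) !(rmorphXn (ev2 _ _)) /= ev2X2 ev2C ev2X1.
  by rewrite rmorphM rmorph_nat; ring.
have Qn0 : Q != 0.
  suff : Q`_(t0.1.2)`_(t0.1.1) != 0 by apply: contraNneq => ->; rewrite !coef0.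
  suff -> : Q`_(t0.1.2)`_(t0.1.1) = c t0 by [].
  rewrite /Q coef_sum coef_sum (bigD1 t0) //= big1 ?addr0 => [|t tt0].
    by rewrite coefCM coefXn !eqxx !mulr1 coefCM coefXn eqxx mulr1.
  rewrite coefCM coefXn; case: (eqVneq (t0.1.2 : nat) t.1.2) => [e2|_]; last first.
    by rewrite mulr0 coef0.
  rewrite mulr1 coefCM coefXn; case: (eqVneq (t0.1.1 : nat) t.1.1) => [e1|_]; last first.
    by rewrite mulr0.
  case: (eqVneq t0.2 t.2) => [e3|_]; last by rewrite mulr0 mul0r.
  case/eqP: tt0; case: t t0 e1 e2 e3 {ct0 Q FQ} => [[t1 t2] t3] [[u1 u2] u3] /=.
  by move=> /val_inj -> /val_inj -> ->.
have Fsz : \forall n \near \oo, (size (F n) <= N.+1)%N.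
  apply: nearW => n; apply/leq_sizeP => i Ni; rewrite FE big1 // => t _.
  by rewrite gtn_eqF ?mulr0 // (leq_trans (ltn_ord _) Ni).
have FT : \forall n \near \oo, (F n).[T n] = 0.
  apply: filterS E0 => n E0n; rewrite -[RHS]E0n horner_sum.
  by apply: eq_bigr => t _; rewrite hornerZ hornerXn.
have Frat : rational_coefs p r F.
  move=> i; under eq_fun do rewrite FE.
  apply: (rational_fun_sum p_exp r_exp l_cvg l_ratio weight_inj_lam) => t.
  apply: rational_funM.
    apply: rational_funM; last exact/rational_funX/rational_fun_r.
    apply: rational_funM; last exact/rational_funX/rational_fun_p.
    exact: rational_fun_rat.
  by have := rational_fun_rat p r (i == t.2)%:R; rewrite rmorph_nat.
have := tail_transcendental p_exp r_exp l_cvg l_ratio weight_inj_lam T_shift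
  T_cvg0 T_irrational p_rat r_rat p_shift_rational r_shift_rational
  Frat Fsz FT t0.2.
have := ev2_neq0 p_exp r_exp l_cvg l_ratio weight_inj_lam Qn0.
move=> [n1 _ H1] [n2 _ H2]; have := H1 (maxn n1 n2) (leq_maxl _ _).
by rewrite -FQ H2 ?eqxx //= leq_maxr.
Qed.

(** * Contradiction with Liouville's inequality *)

Lemma S_transcendental : transcendental S.
Proof.
move=> /algebraic_mult_mx[D [w [q [C [w0 wf q0 Cw]]]]].
(* N K is the total exponent [e] of x_n that the vanishing order M has to beat below. *)
pose K := (4 * d * D + 2 * d + 1)%N.
have [N [M [MN NK]]] : exists N M, (M * M < N.+1 ^ 3)%N /\ (N * K < M)%N.
  (* Here N + 1 = (K+2)^2 and M + 1 = (K+2)^3: M^2 stays just below (N+1)^3 while M exceeds N K. *)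
  exists (K.+2 ^ 2 - 1)%N, (K.+2 ^ 3 - 1)%N; move: K => K.
  have -> : (K.+2 ^ 2 - 1).+1 = (K.+2 ^ 2)%N by rewrite subn1 prednK ?expn_gt0.
  rewrite -expnM (_ : K.+2 ^ (2 * 3) = K.+2 ^ 3 * K.+2 ^ 3)%N; last by rewrite -expnD.
  split; last by rewrite !expnS expn0; nia.
  by apply: ltn_mul; rewrite subn1 prednK ?expn_gt0.
have [c [t0 ct0] [C2 EO]] :=
  auxiliary_polynomial x_ge1 p_bound r_bound has_expansion_T MN.
pose E n := \sum_t ratr (c t) * p n ^+ t.1.1 * r n ^+ t.1.2 * T n ^+ t.2.
apply: (auxiliary_value_nonzero ct0); rewrite -/E.
(* The three powers clear the denominators of p_n^i, r_n^k and T_n^j in turn; x_n T_n is x_n S minus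
   an integer. *)
pose y n := x n.+1 ^+ N * x n.+1 ^+ N * x n ^+ N * E n.
have hX := @mx_heightX _ x _ w.
have hM := @mx_heightM _ x _ w.
have yh : mx_height x w (4 * N * d) y.
  have [a [aE a0 _]] := x_nat.
  have x1h : mx_height x w d (fun n => x n.+1).
    apply: (@mx_height_int _ _ _ _ _ _ (G.[1])%:~R); apply: nearW => n; split.
      by exists (a n.+1)%:Z; rewrite aE.
    by rewrite gtr0_norm // x_succ_le.
  have xh : mx_height x w 1 x.
    apply: (@mx_height_int _ _ _ _ _ _ 1); apply: nearW => n; split.
      by exists (a n)%:Z; rewrite aE.
    by rewrite gtr0_norm // mul1r expr1.
  have Sh : mx_height x w 0 (fun=> S).
    exists q, (\sum_(t : 'I_D.+1 * 'I_D.+1) `|(C t.1 t.2)%:~R|); split=> //.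
    apply: nearW => n; exists C; split=> // i j; rewrite expr0 mulr1.
    by rewrite (bigD1 (i, j)) //= lerDl sumr_ge0.
  have xTh : mx_height x w 1 (fun n => x n * T n).
    rewrite /T; under eq_fun do rewrite mulrBr.
    apply: mx_heightD; first exact: (hM _ _ _ _ xh Sh).
    apply: (@mx_height_int _ _ _ _ _ _ 2).
    apply: nearW => n; split.
      by have [k kE] := x_recip_psum_int n; exists (- k); rewrite rmorphN /= -kE.
    have ps0 : 0 <= recip_psum x n by rewrite -recip_psum0 recip_psum_le.
    rewrite normrN ger0_norm ?mulr_ge0 ?(ltW (x_pos n)) // mulrC expr1.
    rewrite ler_wpM2r ?(ltW (x_pos n)) //; have := recip_psum_ub 0 n.
    by rewrite recip_psum0 hx1 divr1 add0r.
  (* Only nonnegative powers of x_n, x_{n+1} and x_n T_n remain. *)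
  have -> : y = (fun n => \sum_t ratr (c t) * x n.+1 ^+ (N - t.1.1) *
      (x n.+1 ^+ (N - t.1.2) * x n ^+ t.1.2) *
      (x n ^+ (N - t.2) * (x n * T n) ^+ t.2)).
    apply/funext => n; rewrite /y mulr_sumr; apply: eq_bigr => t _.
    have key (z : R) (k : 'I_N.+1) : z != 0 -> z ^+ N * z^-1 ^+ k = z ^+ (N - k).
      move=> z0; have kN : (k <= N)%N by rewrite -ltnS.
      rewrite -[in z ^+ N](subnK kN) exprD -mulrA -exprMn divff //.
      by rewrite expr1n mulr1.
    have x1 : x n.+1 != 0 by rewrite gt_eqF.
    have xT : x n ^+ (N - t.2) * (x n * T n) ^+ t.2 = x n ^+ N * T n ^+ t.2.
      by rewrite exprMn mulrA -exprD subnK // -ltnS.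
    by rewrite xT -!key // /r /p exprMn; ring.
  apply: mx_height_sum => t.
  have := hM _ _ _ _ (hM _ _ _ _ (hM _ _ _ _ (mx_height_rat x w (c t))
    (hX _ (N - t.1.1)%N _ x1h))
    (hM _ _ _ _ (hX _ (N - t.1.2)%N _ x1h) (hX _ t.1.2 _ xh)))
    (hM _ _ _ _ (hX _ (N - t.2)%N _ xh) (hX _ t.2 _ xTh)).
  (* As x_{n+1} = O(x_n^d), the powers of x_{n+1} contribute at most 2 d N, and those of x_n and x_n
     T_n at most 2 N. *)
  move=> h; apply: (mx_height_le x_ge1 _ h).
  have d0 : (0 < d)%N by rewrite /d; lia.
  case: t {h} => [[[t1 /= b1] [t2 /= b2]] [t3 /= b3]].
  clear -b1 b2 b3 d0; nia.
have [C1 yC1] := mx_height_lower_bound w0 wf yh.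
pose g1 : R := (G.[1])%:~R.
pose Z := `|C1| * g1 ^+ N * g1 ^+ N * `|C2|.
have G1 : 0 <= g1 by rewrite ler0z; lia.
near=> n; apply: contrapT => /eqP En0.
have xn0 := x_pos n.
have yn0 : y n != 0 by rewrite /y !mulf_neq0 // expf_neq0 // gt_eqF.
have low : 1 <= C1 * `|y n| * x n ^+ (4 * N * d * D).
  by move: yn0; near: n.
have EC : `|E n| <= C2 * (x n)^-1 ^+ M by near: n.
(* Two terms d N bound the factors x_{n+1}^N, the term N is x_n^N, and the last comes from
   Liouville's inequality; the sum is N K. *)
pose e := (d * N + d * N + N + 4 * N * d * D)%N.
have xM : x n ^+ M <= Z * x n ^+ e.
  have xp k m : 0 <= x m ^+ k by rewrite exprn_ge0 // ltW.
  have xV : x n ^+ M * (x n)^-1 ^+ M = 1.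
    by rewrite -exprMn divff ?expr1n // gt_eqF.
  have EC' : x n ^+ M * `|E n| <= `|C2|.
    apply: le_trans (ler_wpM2l (xp _ _) EC) _.
    by rewrite mulrCA xV mulr1 ler_norm.
  have x1N : x n.+1 ^+ N <= g1 ^+ N * x n ^+ (d * N).
    rewrite exprM -exprMn; apply: lerXn2r; rewrite ?nnegrE ?(ltW (x_pos _)) //.
      by rewrite mulr_ge0.
    exact: x_succ_le.
  have yE : `|y n| = x n.+1 ^+ N * x n.+1 ^+ N * x n ^+ N * `|E n|.
    by rewrite /y normrM ger0_norm // !mulr_ge0.
  have low' : 1 <= `|C1| * `|y n| * x n ^+ (4 * N * d * D).
    by apply: le_trans low _; rewrite ler_wpM2r // ler_wpM2r // ler_norm.
  have := ler_wpM2l (xp M n) low'; rewrite mulr1 => /le_trans; apply.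
  have -> : x n ^+ M * (`|C1| * `|y n| * x n ^+ (4 * N * d * D)) =
    (`|C1| * x n ^+ N * x n ^+ (4 * N * d * D)) *
    ((x n.+1 ^+ N * x n.+1 ^+ N) * (x n ^+ M * `|E n|)) by rewrite yE; ring.
  have -> : Z * x n ^+ e = (`|C1| * x n ^+ N * x n ^+ (4 * N * d * D)) *
    ((g1 ^+ N * x n ^+ (d * N) * (g1 ^+ N * x n ^+ (d * N))) * `|C2|).
    by rewrite /Z /e !exprD; ring.
  apply: ler_wpM2l; first by rewrite !mulr_ge0.
  by apply: ler_pM => //; rewrite ?mulr_ge0 // ler_pM.
(* Since e < M, cancelling x_n^e leaves x_n bounded by a constant, against its divergence. *)
have xZ : x n <= Z.
  rewrite -(@ler_pM2r _ (x n ^+ e)) ?exprn_gt0 // -exprS.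
  apply: le_trans xM; rewrite ler_weXn2l //.
  move: NK; rewrite /K /e; clear; nia.
have : Z + 1 <= x n.
  by near: n; have /cvgryPge := x_cvg; apply.
by lra.
Unshelve. all: by end_near. Qed.

End RecurrenceSequence.

Theorem theorem5 (R : realType) (d1 d2 : nat) (G : {poly int}) (x : nat -> R)
    (hd1 : (3 <= d1)%N)
    (hGnonneg : forall i : nat, 0 <= G`_i)
    (hGdeg : size G = d2.+1)
    (hG0 : G.[0] != 0)
    (hG1 : 3 <= G.[1])
    (hx0 : x 0%N = 1)
    (hx1 : x 1%N = 1)
    (hxrec : forall n : nat,
       x n.+2 * x n = x n.+1 ^+ d1 * (map_poly intr G).[x n.+1]) :
  (exists a : nat -> nat,
     [/\ forall n : nat, x n = (a n)%:R,
         forall n : nat, (0 < a n)%N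
       & forall n : nat, (a n ^ 2 %| a n.+1)%N])
  /\ cvgn (recip_psum x)
  /\ transcendental (limn (recip_psum x)).
Proof.
split; first by apply: x_nat; eassumption.
split; first by apply: recip_psum_cvg; eassumption.
by apply: S_transcendental; eassumption.
Qed.
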